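(* Let the Finsler space $F^N$ be conformally isomorphic to the Riemannian space $R^N=\{M,a_{mn}(x)\}$ by means of a fibrewise transformation $y\mapsto \zeta(x,y)$, positively homogeneous of degree $h>0$ in $y$ and sending unit vectors to unit vectors, such that $$g_{mn}(x,y)=\varkappa^2\,\zeta^i_m\,\zeta^j_n\,a_{ij}(x),\qquad \varkappa=\frac1hK^{1-h},\qquad \zeta^i_m=\frac{\partial\zeta^i}{\partial y^m}.$$ Assume $h=\text{const}$ (independent of $x\in M$). Let $$N^m_n=-y^m_i\Bigl(\frac{\partial\zeta^i}{\partial x^n}+a^i{}_{kn}\zeta^k\Bigr),\qquad D^k{}_{in}=-\frac{\partial N^k_i}{\partial y^n},\qquad N^j_i=-D^j{}_{ik}y^k .$$ Then the vanishing set $$\mathcal D_iK=0,\qquad \mathcal D_iy^j=0,\qquad \mathcal D_iy_j=0$$ and the metricity $$\mathcal D_i g_{jn}=0$$ hold. Moreover the angle is preserved: $$\Bigl(\frac{\partial}{\partial x^i}+N^k_i(x,y_1)\frac{\partial}{\partial y_1^k}+N^k_i(x,y_2)\frac{\partial}{\partial y_2^k}\Bigr)\alpha_{\{x\}}(y_1,y_2)=0 .$$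
   Context: $M$ is an $N$-dimensional differentiable manifold with local coordinates $x^i$, and $y^i$ are the induced components of tangent vectors $y\in T_xM$. The Finsler space $F^N$ is given by a Finsler metric function $K(x,y)>0$ on $TM\setminus 0$ (positively homogeneous of degree 1 in $y$ and strongly convex), with metric tensor $g_{mn}=\frac12\,\partial^2K^2/\partial y^m\partial y^n$ and $y_j=g_{jk}y^k=\frac12\partial K^2/\partial y^j$. $a_{mn}(x)$ is a Riemannian metric tensor on $M$ with Christoffel symbols $a^i{}_{kn}=a^i{}_{kn}(x)$, and $S(x,\zeta)=\sqrt{a_{mn}(x)\zeta^m\zeta^n}$. The fibrewise transformation is, for each $x\in M$, a diffeomorphism $y\mapsto\zeta(x,y)$ between open regions of $T_xM\setminus\{0\}$ (invariant under multiplication by positive numbers), of class $C^5$ in $y$ and $C^4$ in $x$, with inverse $y^i=y^i(x,\zeta)$; $y^m_i=\partial y^m/\partial\zeta^i$ is the inverse matrix of $\zeta^i_m$. Homogeneity means $\zeta^i(x,\gamma y)=\gamma^{h}\zeta^i(x,y)$ for all $\gamma>0$; sending unit vectors to unit vectors means $K(x,y)=1$ if and only if $S(x,\zeta(x,y))=1$. The operator $d_i=\partial/\partial x^i+N^k_i\,\partial/\partial y^k$, and the covariant derivative $\mathcal D_i$ is exemplified by $$\mathcal D_iw^n{}_m=d_iw^n{}_m+D^n{}_{ih}w^h{}_m-D^h{}_{im}w^n{}_h$$ for a differentiable $(1,1)$-tensor $w^n{}_m(x,y)$, with the analogous rule for other types (in particular $\mathcal D_iK=d_iK$). The angle $\alpha_{\{x\}}(y_1,y_2)$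 is the length of the geodesic arc, on the indicatrix $\{y\in T_xM:K(x,y)=1\}$ with the Riemannian metric induced from $(T_xM,g_{mn}(x,\cdot))$, joining $y_1/K(x,y_1)$ and $y_2/K(x,y_2)$; in the present setting it equals $\frac1h\arccos\frac{a_{mn}\zeta^m(x,y_1)\zeta^n(x,y_2)}{S(x,\zeta(x,y_1))S(x,\zeta(x,y_2))}$.
   Formalization: The angle is taken along geodesic arcs of the indicatrix inside the region where ζ is defined; y_1, y_2 must be joined there by such an arc of length < π/h, and the sum of separate partial derivatives is asserted only when y_1, y_2 lie on different rays. *)

(* Defs.v *)
From mathcomp Require Import all_boot all_order all_algebra.
From mathcomp Require Import all_classical all_reals all_analysis.

Set Implicit Arguments.
Unset Strict Implicit.
Unset Printing Implicit Defensive.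

Import Order.TTheory GRing.Theory Num.Theory.
Import numFieldNormedType.Exports.

Local Open Scope classical_set_scope.
Local Open Scope ring_scope.

(** Points, tangent vectors and their components are row vectors; a function
    on (part of) the tangent bundle is represented, in a given coordinate
    system, by a curried function [f x y] of the coordinates x^i and of the
    induced components y^i. *)

Definition base {R : realType} {N : nat} (i : 'I_N) : 'rV[R]_N := delta_mx 0 i.

Definition pd {R : realType} {N : nat} (i : 'I_N) (f : 'rV[R]_N -> R)
    (x : 'rV[R]_N) : R := 'D_(base i) f x.

Definition pdx {R : realType} {N : nat} (i : 'I_N)
    (f : 'rV[R]_N -> 'rV[R]_N -> R) (x y : 'rV[R]_N) : R :=
  pd i (fun x' => f x' y) x.

Definition pdy {R : realType} {N : nat} (k : 'I_N)
    (f : 'rV[R]_N -> 'rV[R]_N -> R) (x y : 'rV[R]_N) : R :=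
  pd k (f x) y.

Fixpoint Ck {R : realType} {N : nat} (k : nat) (U : set 'rV[R]_N)
    (f : 'rV[R]_N -> R) : Prop :=
  (forall x, U x -> {for x, continuous f}) /\
  match k with
  | 0 => True
  | k'.+1 => forall i, (forall x, U x -> derivable f x (base i)) /\
                       Ck k' U (pd i f)
  end.

(** [Cxy p n W f]: on the open set W, f has continuous iterated partial
    derivatives up to total order n, among which at most p are taken with
    respect to x.  "Of class C^5 in y and C^4 in x" is [Cxy 4 5]; bounding the
    total order makes the class independent of the coordinate system, since a
    change of coordinates of M turns one x-derivative into a combination of
    x- and y-derivatives. *)
Fixpoint Cxy {R : realType} {N : nat} (p n : nat)
    (W : set ('rV[R]_N * 'rV[R]_N)) (f : 'rV[R]_N -> 'rV[R]_N -> R)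
    {struct n} : Prop :=
  (forall w, W w ->
     {for w, continuous (fun u : 'rV[R]_N * 'rV[R]_N => f u.1 u.2)}) /\
  match n with
  | 0 => True
  | n'.+1 =>
      (match p with
       | 0 => True
       | p'.+1 => forall i,
           (forall x y, W (x, y) -> derivable (fun x' => f x' y) x (base i)) /\
           Cxy p' n' W (pdx i f)
       end) /\
      (forall k,
         (forall x y, W (x, y) -> derivable (f x) y (base k)) /\
         Cxy p n' W (pdy k f))
  end.

(** An N-dimensional smooth manifold, given by an atlas. *)
Record manifold (R : realType) (N : nat) := Manifold {
  carrier : topologicalType;
  chart : Type;
  dom : chart -> set carrier;
  crd : chart -> carrier -> 'rV[R]_N;
  pt : chart -> 'rV[R]_N -> carrier;
  carrier_hausdorff : hausdorff_space carrier;
  carrier_second_countable : @second_countable carrier;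
  dom_cover : forall p, exists c, dom c p;
  dom_open : forall c, open (dom c);
  crd_open : forall c, open (crd c @` dom c);
  crdK : forall c p, dom c p -> pt c (crd c p) = p;
  crd_continuous : forall c p, dom c p -> {for p, continuous (crd c)};
  pt_continuous : forall c x, (crd c @` dom c) x -> {for x, continuous (pt c)};
  transition_smooth : forall c c' k i,
    Ck k (crd c @` (dom c `&` dom c')) (fun x => crd c' (pt c x) 0 i)
}.

Section ManifoldObjects.
Context {R : realType} {N : nat} {M : manifold R N}.
Implicit Types c : chart M.

Definition img c : set 'rV[R]_N := @crd _ _ M c @` @dom _ _ M c.

Definition overlap c c' : set 'rV[R]_N :=
  @crd _ _ M c @` (@dom _ _ M c `&` @dom _ _ M c').

Definition trans c c' (x : 'rV[R]_N) : 'rV[R]_N := crd c' (pt c x).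

(** The components of a tangent vector change by [y |-> y *m jac c c' x]. *)
Definition jac c c' (x : 'rV[R]_N) : 'M[R]_N :=
  \matrix_(i, j) pd i (fun x' => trans c c' x' 0 j) x.

Definition slit_tangent c : set ('rV[R]_N * 'rV[R]_N) :=
  [set w | img c w.1 /\ w.2 != 0].

(** Coordinate expressions, one for each chart, of a region of TM \ 0 that is
    invariant under multiplication of vectors by positive numbers. *)
Definition conic_region (D : chart M -> set ('rV[R]_N * 'rV[R]_N)) : Prop :=
  [/\ forall c, open (D c),
      forall c, D c `<=` slit_tangent c,
      forall c x y (gam : R), 0 < gam -> D c (x, y) -> D c (x, gam *: y) &
      forall c c' x y, overlap c c' x ->
        (D c (x, y) <-> D c' (trans c c' x, y *m jac c c' x))].

End ManifoldObjects.

Section LocalTensors.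
Context {R : realType} {N : nat}.
Implicit Types (K : 'rV[R]_N -> 'rV[R]_N -> R) (a : 'rV[R]_N -> 'M[R]_N).
Implicit Types (zeta eta : 'rV[R]_N -> 'rV[R]_N -> 'rV[R]_N).
Implicit Types (x y z : 'rV[R]_N) (i j k l m n : 'I_N).

Definition gten K m n x y : R :=
  pdy m (pdy n (fun x' y' => K x' y' ^+ 2)) x y / 2.

Definition ylow K j x y : R := \sum_k gten K j k x y * y 0 k.

Definition christoffel a i k n x : R :=
  \sum_l invmx (a x) i l *
    (pd k (fun x' => a x' l n) x + pd n (fun x' => a x' l k) x
     - pd l (fun x' => a x' k n) x) / 2.

Definition Snorm a x z : R := Num.sqrt (\sum_m \sum_n a x m n * z 0 m * z 0 n).

Definition zetad zeta i m x y : R := pdy m (fun x' y' => zeta x' y' 0 i) x y.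

(** Here [eta x] is the inverse z |-> y(x, z) of [zeta x], and y^m_i is its
    derivative with respect to z^i at z = zeta(x, y). *)
Definition yinvd zeta eta m i x y : R :=
  pdy i (fun x' z => eta x' z 0 m) x (zeta x y).

Definition Nco zeta eta a m n x y : R :=
  - \sum_i yinvd zeta eta m i x y *
      (pdx n (fun x' y' => zeta x' y' 0 i) x y
       + \sum_k christoffel a i k n x * zeta x y 0 k).

(** [Dco Nc k i n] is D^k_{in}. *)
Definition Dco (Nc : 'I_N -> 'I_N -> 'rV[R]_N -> 'rV[R]_N -> R) k i n x y : R :=
  - pdy n (Nc k i) x y.

Definition dop (Nc : 'I_N -> 'I_N -> 'rV[R]_N -> 'rV[R]_N -> R) i
    (w : 'rV[R]_N -> 'rV[R]_N -> R) x y : R :=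
  pdx i w x y + \sum_k Nc k i x y * pdy k w x y.

(** The covariant derivative [D_i] on tensors of type (0,0), (1,0), (0,1) and
    (0,2). *)
Definition cov00 (Nc : 'I_N -> 'I_N -> 'rV[R]_N -> 'rV[R]_N -> R) i
    (w : 'rV[R]_N -> 'rV[R]_N -> R) x y : R :=
  dop Nc i w x y.

Definition cov10 (Nc : 'I_N -> 'I_N -> 'rV[R]_N -> 'rV[R]_N -> R) i
    (w : 'I_N -> 'rV[R]_N -> 'rV[R]_N -> R) j x y : R :=
  dop Nc i (w j) x y + \sum_l Dco Nc j i l x y * w l x y.

Definition cov01 (Nc : 'I_N -> 'I_N -> 'rV[R]_N -> 'rV[R]_N -> R) i
    (w : 'I_N -> 'rV[R]_N -> 'rV[R]_N -> R) j x y : R :=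
  dop Nc i (w j) x y - \sum_l Dco Nc l i j x y * w l x y.

Definition cov02 (Nc : 'I_N -> 'I_N -> 'rV[R]_N -> 'rV[R]_N -> R) i
    (w : 'I_N -> 'I_N -> 'rV[R]_N -> 'rV[R]_N -> R) j n x y : R :=
  dop Nc i (w j n) x y - \sum_l Dco Nc l i j x y * w l n x y
  - \sum_l Dco Nc l i n x y * w j l x y.

(** Christoffel symbols [ij,k] of the first kind of the Riemannian metric
    g_{mn}(x, .) on T_xM. *)
Definition gchr K i j k x y : R :=
  (pdy i (gten K j k) x y + pdy j (gten K i k) x y - pdy k (gten K i j) x y) / 2.

Definition unit_vec K x y : 'rV[R]_N := (K x y)^-1 *: y.

(** A geodesic arc, parametrized by [0, 1], from p to q on the indicatrix
    K(x, .) = 1 within the region W.  For the metric induced on a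
    hypersurface, a curve is a geodesic iff its acceleration with respect to
    the Levi-Civita connection of the ambient metric g_{mn}(x, .) is orthogonal
    to the tangent spaces of the hypersurface. *)
Definition geodesic_arc (W : set ('rV[R]_N * 'rV[R]_N)) K x
    (p q : 'rV[R]_N) (c : R -> 'rV[R]_N) : Prop :=
  [/\ c 0 = p /\ c 1 = q,
      {within `[0, 1], continuous c},
      forall t, 0 <= t <= 1 -> W (x, c t) /\ K x (c t) = 1,
      forall t, 0 < t < 1 -> derivable c t 1 /\ derivable (derive1 c) t 1 &
      forall t, 0 < t < 1 -> forall v : 'rV[R]_N,
        \sum_k pdy k K x (c t) * v 0 k = 0 ->
        \sum_k (\sum_l gten K l k x (c t) * derive1 (derive1 c) t 0 l
                + \sum_i \sum_j gchr K i j k x (c t)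
                    * derive1 c t 0 i * derive1 c t 0 j) * v 0 k = 0].

Definition arc_length K x (c : R -> 'rV[R]_N) : R :=
  \int[lebesgue_measure]_(t in `[0, 1])
    Num.sqrt (\sum_m \sum_n gten K m n x (c t) * derive1 c t 0 m * derive1 c t 0 n).

(** The angle, the Finsler space being considered over the region W.  Geodesic
    arcs joining two points need not be unique (a great circle has two arcs):
    the length of the shortest one is taken. *)
Definition angle (W : set ('rV[R]_N * 'rV[R]_N)) K x y1 y2 : R :=
  inf [set L | exists2 c,
         geodesic_arc W K x (unit_vec K x y1) (unit_vec K x y2) c &
         L = arc_length K x c].

End LocalTensors.

Section Structures.
Context {R : realType} {N : nat} (M : manifold R N).

(** Tensorial objects are given by their components in every chart, subject
    to the transformation law under changes of coordinates. *)

Record finsler_metric (K : chart M -> 'rV[R]_N -> 'rV[R]_N -> R) : Prop :=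
  FinslerMetric {
  finsler_law : forall c c' x y, overlap c c' x -> y != 0 ->
    K c' (trans c c' x) (y *m jac c c' x) = K c x y;
  finsler_reg : forall c, Cxy 4 5 (slit_tangent c) (K c);
  finsler_gt0 : forall c x y, img c x -> y != 0 -> 0 < K c x y;
  finsler_hom : forall c x y (gam : R), img c x -> y != 0 -> 0 < gam ->
    K c x (gam *: y) = gam * K c x y;
  finsler_convex : forall c x y (v : 'rV[R]_N), img c x -> y != 0 -> v != 0 ->
    0 < \sum_m \sum_n gten (K c) m n x y * v 0 m * v 0 n
}.

Record riemannian_metric (a : chart M -> 'rV[R]_N -> 'M[R]_N) : Prop :=
  RiemannianMetric {
  riem_law : forall c c' x, overlap c c' x ->
    a c x = jac c c' x *m a c' (trans c c' x) *m (jac c c' x)^T;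
  riem_reg : forall c i j, Ck 4 (img c) (fun x => a c x i j);
  riem_sym : forall c x, img c x -> (a c x)^T = a c x;
  riem_pos : forall c x (v : 'rV[R]_N), img c x -> v != 0 ->
    0 < \sum_m \sum_n a c x m n * v 0 m * v 0 n
}.

(** [zeta] maps, over each x, the region D_x of T_xM \ 0 diffeomorphically
    onto the region E_x, with inverse [eta]. *)
Record fibrewise_diffeo (D E : chart M -> set ('rV[R]_N * 'rV[R]_N))
    (zeta eta : chart M -> 'rV[R]_N -> 'rV[R]_N -> 'rV[R]_N) : Prop :=
  FibrewiseDiffeo {
  fib_source : conic_region D;
  fib_target : conic_region E;
  fib_law : forall c c' x y, overlap c c' x -> D c (x, y) ->
    zeta c' (trans c c' x) (y *m jac c c' x) = zeta c x y *m jac c c' x;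
  fib_to : forall c x y, D c (x, y) ->
    E c (x, zeta c x y) /\ eta c x (zeta c x y) = y;
  fib_from : forall c x z, E c (x, z) ->
    D c (x, eta c x z) /\ zeta c x (eta c x z) = z;
  fib_reg : forall c i, Cxy 4 5 (D c) (fun x y => zeta c x y 0 i);
  fib_inv_reg : forall c i, Cxy 4 5 (E c) (fun x z => eta c x z 0 i)
}.

(** The Finsler space (M, K) is conformally isomorphic to the Riemannian space
    (M, a) by means of [zeta], of constant degree of homogeneity h. *)
Record conformal_isomorphism (K : chart M -> 'rV[R]_N -> 'rV[R]_N -> R)
    (a : chart M -> 'rV[R]_N -> 'M[R]_N)
    (D E : chart M -> set ('rV[R]_N * 'rV[R]_N))
    (zeta eta : chart M -> 'rV[R]_N -> 'rV[R]_N -> 'rV[R]_N) (h : R) : Prop :=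
  ConformalIsomorphism {
  conf_diffeo : fibrewise_diffeo D E zeta eta;
  conf_degree : 0 < h;
  conf_hom : forall c x y (gam : R), D c (x, y) -> 0 < gam ->
    zeta c x (gam *: y) = gam `^ h *: zeta c x y;
  conf_unit : forall c x y, D c (x, y) ->
    (K c x y = 1 <-> Snorm (a c) x (zeta c x y) = 1);
  conf_metric : forall c x y m n, D c (x, y) ->
    gten (K c) m n x y =
    (h^-1 * K c x y `^ (1 - h)) ^+ 2 *
    \sum_i \sum_j zetad (zeta c) i m x y * zetad (zeta c) j n x y * a c x i j
}.

End Structures.

(* Main.v *)
From HB Require Import structures.
Require Import Defs.
From mathcomp Require Import all_boot all_order all_algebra.
From mathcomp Require Import all_classical all_reals all_analysis.
From mathcomp Require Import ring lra.
Import Order.TTheory GRing.Theory Num.Theory.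
Import numFieldNormedType.Exports.
Local Open Scope classical_set_scope.
Local Open Scope ring_scope.

Set Implicit Arguments.
Unset Strict Implicit.
Unset Printing Implicit Defensive.

(** Over a point [x] the transformation [zeta] carries the indicatrix
    [K = 1] onto the unit sphere of the Euclidean space [(T_xM, a(x))], and on
    the indicatrix the conformal factor is the constant [h^-2].  The
    coefficients [N^k_i] are made so that moving along [d_i] transports the
    image [zeta] of a vector parallelly for the Levi-Civita connection of [a]:
    [d_i zeta^j = - a^j_{mi} zeta^m] ([zeta_transport]).  Everything follows
    from this identity and from [nabla a = 0] ([metricity]).

    Vanishing set and metricity.  Homogeneity and the correspondence of unit
    vectors give [a(zeta, zeta) = K^(2h)] ([bil_zeta]), and the left-hand side
    is preserved by parallel transport, so [d_i K = 0] ([dop_K]).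
    Differentiating the transport identity in [y^n], which exchanges mixed
    partial derivatives ([schwarz]), shows that the covectors
    [zeta^j_n] are parallel too, up to the [D]-terms that define the covariant
    derivative ([zetad_transport]).  Since [g] is [K^(2-2h)/h^2] times the
    pullback of [a] by these covectors, [D_i g = 0] ([cov_g]).  Contracting
    the differentiated identity with [y], by Euler's theorem for [zeta],
    shows that [N^k_i] is homogeneous of degree one in [y] ([Nc_euler]): this
    is the relation between [N] and [D], and it is [D_i y = 0] ([cov_y]).
    With [D_i g = 0] it yields [D_i y_j = 0] ([cov_ylow]).

    The angle.  For directions tangent to the indicatrix the derivative of the
    conformal factor drops out of the Christoffel symbols of [g]
    ([geodesic_expr]), so [zeta] identifies geodesic arcs of the indicatrix
    with arcs of great circles, and multiplies lengths by [h]
    ([geodesic_great_circle], [great_circle_geodesic]).  Two unit vectors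
    [z1], [z2] that subtend an angle [s < pi] are joined, up to full turns, by
    the minor arc, of length [s], and [|z1 - z2| = 2 sin (s/2)]; hence the
    angle is [2/h asin (|z1 - z2| / 2)] as soon as the minor arc lies in the
    target region ([angle_value]).  The target is a cone, so this condition
    says that it contains the segment from [z1] to [z2]; it holds
    at the given point because a geodesic arc shorter than [pi / h] exists
    ([cone_of_geodesic]), and then at all nearby points by compactness of the
    segment ([near_cone]).  Finally the two normalized images are
    transported parallelly, so [|z1 - z2|] is stationary along
    [d_i] and so is the angle ([is_derive_angle]).  The chord, rather than the
    arc cosine of the scalar product, is used because this formula can be
    differentiated even when [z1 = z2]. *)

(** * Differential calculus in normed modules *)

Section Calculus.
Context {R : realType} {V : normedModType R}.
Implicit Types (F G : V -> R) (p q v e : V).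

Lemma is_derive_line (W : normedModType R) (F : V -> W) p v l : is_derive p v F l <->
  is_derive (0 : R) (1 : R) (fun t : R => F (t *: v + p)) l.
Proof.
have E : (fun h : R => h^-1 *: (F (h *: v + p) - F p)) =
   (fun h : R => h^-1 *: (F ((h *: (1 : R^o) + 0 : R) *: v + p) - F (0 *: v + p))).
  by apply/funext => h; rewrite addr0 scale0r add0r [_%:A]mulr1.
by split => -[H1 H2]; split; move: H1 H2; rewrite /derivable /derive /= E.
Qed.

Lemma is_derive_lineP F p v l (t : R) : is_derive (t *: v + p) v F l <->
  is_derive t (1 : R) (fun s : R => F (s *: v + p)) l.
Proof.
have E : (fun h : R => h^-1 *: (F (h *: v + (t *: v + p)) - F (t *: v + p))) =
   (fun h : R => h^-1 *: (F ((h *: (1 : R^o) + t : R) *: v + p) - F (t *: v + p))).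
  by apply/funext => h; rewrite scalerDl [_%:A]mulr1 addrA.
by split => -[H1 H2]; split; move: H1 H2; rewrite /derivable /derive /= E.
Qed.

Lemma is_derive_comp_real (f : R -> R) F p v a l :
  is_derive (F p) (1 : R) f a -> is_derive p v F l ->
  is_derive p v (fun q => f (F q)) (a * l).
Proof.
move=> df /is_derive_line dF; apply/is_derive_line.
apply: (@is_derive1_comp R f (fun t : R => F (t *: v + p))).
by rewrite scale0r add0r.
Qed.

Lemma mvt_line F p v (df : R -> R) :
  (forall s, 0 <= s <= 1 -> is_derive (s *: v + p) v F (df s)) ->
  exists2 s, 0 <= s <= 1 & F (v + p) - F p = df s.
Proof.
move=> H.
have [||s] := @MVT_segment R (fun s => F (s *: v + p)) df 0 1 ler01.
- by move=> s /[!in_itv]/= /andP[s0 s1]; apply/is_derive_lineP/H; rewrite !ltW.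
- apply: derivable_within_continuous => s /[!in_itv]/= s01.
  by have /is_derive_lineP[] := H _ s01.
rewrite in_itv/= => s01; rewrite scale1r scale0r add0r subr0 mulr1 => E.
by exists s.
Qed.

Lemma is_derive_scale F p v l (t : R) :
  is_derive p v F l -> is_derive p (t *: v) F (t * l).
Proof.
move=> /is_derive_line dF; apply/is_derive_line.
rewrite (_ : (fun s : R => _) =
   (fun s : R => F (s *: v + p)) \o (fun s : R => t * s)); last first.
  by apply/funext => s /=; rewrite scalerA mulrC.
rewrite mulrC.
apply: is_derive1_comp; first by rewrite mulr0.
by apply: (is_derive_eq (is_deriveZ _ _)); rewrite [_ *: _]mulr1.
Qed.

(** If a directional derivative exists near [p] and is continuous at [p], the
    mean value theorem makes difference quotients converge uniformly in the
    base point.  Both the differentiability of functions with continuous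
    partial derivatives and the symmetry of second derivatives rest on this
    uniformity. *)
Lemma strict_derive F G p e :
  (\forall q \near p, is_derive q e F (G q)) -> {for p, continuous G} ->
  forall eps : R, 0 < eps -> exists2 r : R, 0 < r &
    forall q (t : R), `|q - p| < r -> `|t| < r ->
      `|F (t *: e + q) - F q - t * G p| <= eps * `|t|.
Proof.
move=> dF cF eps eps0.
have : \forall q \near p, is_derive q e F (G q) /\ `|G p - G q| < eps.
  near=> q; split; first by near: q.
  by near: q; move/cvgrPdist_lt: cF => /(_ _ eps0).
move=> /nbhs_ballP[r /= r0 Hr].
have ne0 : 0 < `|e| + 1 by rewrite ltr_wpDl.
exists (Num.min (r / 2) (r / 2 / (`|e| + 1))).
  by rewrite lt_min !divr_gt0.
move=> q t; rewrite !lt_min => /andP[qp _] /andP[_ te].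
have Hb s : 0 <= s <= 1 -> ball p r (s *: (t *: e) + q).
  move=> /andP[s0 s1]; rewrite -ball_normE/= opprD addrCA.
  rewrite (le_lt_trans (ler_normD _ _))// (splitr r) ltr_leD//; last first.
    by rewrite distrC ltW.
  rewrite normrN !normrZ (ger0_norm s0).
  have : `|t| * `|e| < r / 2.
    rewrite (@le_lt_trans _ _ (`|t| * (`|e| + 1)))// ?ler_wpM2l ?lerDl//.
    by rewrite -ltr_pdivlMr.
  by apply: le_lt_trans; rewrite ler_piMl// mulr_ge0.
have [s s01 ->] : exists2 s, 0 <= s <= 1 &
    F (t *: e + q) - F q = t * G (s *: (t *: e) + q).
  apply: (@mvt_line _ _ _ (fun s => t * G (s *: (t *: e) + q))) => s s01.
  by apply: is_derive_scale; have [] := Hr _ (Hb _ s01).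
rewrite -mulrBr normrM mulrC ler_wpM2r// distrC ltW//.
by have [] := Hr _ (Hb _ s01).
Unshelve. all: by end_near. Qed.

(** The second difference of [F] over the parallelogram spanned by [t e] and
    [t e'] is symmetric in [e] and [e'], and is approximated by [t^2] times
    either mixed derivative.  The derivatives are passed as functions [G],
    [H], ... so that partial derivatives can be supplied in any form. *)
Lemma schwarz F G G' H H' p e e' :
  (\forall q \near p, [/\ is_derive q e F (G q), is_derive q e' F (G' q),
     is_derive q e' G (H q) & is_derive q e G' (H' q)]) ->
  {for p, continuous H} -> {for p, continuous H'} -> H p = H' p.
Proof.
(* [D] is a first difference of [F] in the direction [b]: the mean value
   theorem in the direction [a], then the uniform estimate for [A]. *)
have half : forall (a b : V) (A B : V -> R),
    (\forall q \near p, is_derive q a F (A q) /\ is_derive q b A (B q)) ->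
    {for p, continuous B} ->
  forall eps : R, 0 < eps -> exists2 r : R, 0 < r &
    forall t : R, `|t| < r ->
     `|F (t *: a + (t *: b + p)) - F (t *: b + p) - F (t *: a + p) + F p
       - t ^+ 2 * B p| <= eps * t ^+ 2.
  move=> a b A B nF cF eps eps0.
  have n1 : \forall q \near p, is_derive q b A (B q).
    by apply: filterS nF => q [].
  have [r1 r10 H1] := strict_derive n1 cF eps0.
  move: nF => /nbhs_ballP[r2 /= r20 H2].
  pose r := Num.min r1 r2.
  have r0 : 0 < r by rewrite lt_min r10.
  have Hpos : 0 < `|a| + `|b| + 1 by rewrite ltr_wpDl// addr_ge0.
  exists (Num.min r (r / (`|a| + `|b| + 1))).
    by rewrite lt_min r0 divr_gt0.
  move=> t; rewrite lt_min => /andP[tr1 tr2].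
  have tab : `|t| * `|a| + `|t| * `|b| < r.
    rewrite -mulrDr (@le_lt_trans _ _ (`|t| * (`|a| + `|b| + 1)))//.
      by rewrite ler_wpM2l// lerDl.
    by rewrite -ltr_pdivlMr.
  have Ha s : 0 <= s <= 1 -> `|s *: (t *: a)| <= `|t| * `|a|.
    move=> /andP[s0 s1]; rewrite !normrZ (ger0_norm s0) ler_piMl// mulr_ge0.
  have Hball s : 0 <= s <= 1 -> ball p r (s *: (t *: a) + (t *: b + p)) /\
                               ball p r (s *: (t *: a) + p).
    move=> s01; rewrite -ball_normE/=; split.
      rewrite distrC addrA addrK (le_lt_trans (ler_normD _ _))//.
      by apply: le_lt_trans tab; rewrite lerD ?Ha// normrZ.
    rewrite distrC addrK (le_lt_trans (Ha _ s01))//.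
    by apply: le_lt_trans tab; rewrite lerDl mulr_ge0.
  have br2 q : ball p r q -> ball p r2 q by apply: le_ball; rewrite ge_min lexx orbT.
  pose D q := F (t *: b + q) - F q.
  have [s s01 E] : exists2 s, 0 <= s <= 1 & D (t *: a + p) - D p =
      t * (A (t *: b + (s *: (t *: a) + p)) - A (s *: (t *: a) + p)).
    apply: (@mvt_line D _ _ (fun s => t * (A (t *: b + (s *: (t *: a) + p))
        - A (s *: (t *: a) + p)))) => s s01.
    have [/br2/H2[d1 _] /br2/H2[d2 _]] := Hball _ s01.
    apply: is_derive_scale; apply: is_deriveB => //.
    move: d1; rewrite addrCA => /is_derive_line d1.
    by apply/is_derive_line; under eq_fun do rewrite addrCA.
  have -> : F (t *: a + (t *: b + p)) - F (t *: b + p) - F (t *: a + p) + F p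
      = D (t *: a + p) - D p.
    by rewrite /D (addrCA (t *: b)); ring.
  rewrite E expr2 -mulrA -mulrBr normrM mulrA mulrC -[X in _ <= X]mulrA.
  rewrite -[X in _ <= _ * X]expr2 -real_normK ?num_real// expr2 mulrA ler_wpM2r//.
  apply: H1; last by rewrite (lt_le_trans tr1)// ge_min lexx.
  have [_] := Hball _ s01; rewrite -ball_normE/= distrC => /lt_le_trans; apply.
  by rewrite ge_min lexx.
move=> nF c1 c2; apply/eqP; rewrite -subr_eq0 -normr_le0.
apply/ler_addgt0Pr => eps eps0; rewrite add0r.
have e20 : 0 < eps / 2 by rewrite divr_gt0.
have [|r1 r10 K1] := half e e' G H _ c1 _ e20; first by apply: filterS nF => q [].
have [|r2 r20 K2] := half e' e G' H' _ c2 _ e20; first by apply: filterS nF => q [].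
pose t := Num.min r1 r2 / 2.
have t0 : 0 < t by rewrite divr_gt0// lt_min r10.
have tm : `|t| < Num.min r1 r2.
  by rewrite gtr0_norm// /t ltr_pdivrMr// mulr_natr mulr2n ltrDl lt_min r10.
move: tm; rewrite lt_min => /andP[/K1{}K1 /K2{}K2].
have t20 : 0 < t ^+ 2 by rewrite exprn_gt0.
move: K1 K2; rewrite [t *: e' + (_ + _)]addrCA.
move: (F _) (F _) (F _) (F _) (H p) (H' p) => A B C P X Y K1 K2.
rewrite -(ler_pM2l t20) -[t ^+ 2 in X in X <= _]gtr0_norm// -normrM.
rewrite (_ : t ^+ 2 * (X - Y) = (P - B - C + A - t ^+ 2 * Y)
  - (P - C - B + A - t ^+ 2 * X)); last by ring.
rewrite (_ : t ^+ 2 * eps = eps / 2 * t ^+ 2 + eps / 2 * t ^+ 2); last by field.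
apply: (le_trans (ler_normB _ _)). exact: lerD.
Qed.

(** The coordinates [phi] of [V] relative to the vectors [e] are explicit, so
    that the same argument serves [R^N] and [R^N * R^N]. *)
Section ContinuousPartials.
Variables (I : finType) (e : I -> V) (phi : I -> V -> R).
Hypothesis phi_linear : forall k, linear (phi k : V -> R^o).
Hypothesis phi_le : forall k v, `|phi k v| <= `|v|.
Hypothesis phi_coord : forall v, v = \sum_k phi k v *: e k.

(** One coordinate is changed at a time; the intermediate points stay close to
    [p], which is where the uniformity of [strict_derive] is needed. *)
Lemma partials_expansion F (D : I -> V -> R) p (s : seq I) :
  (forall k, \forall q \near p, is_derive q (e k) F (D k q)) ->
  (forall k, {for p, continuous (D k)}) ->
  forall eps : R, 0 < eps -> exists2 r : R, 0 < r & forall v, `|v| < r ->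
    `|F (\sum_(k <- s) phi k v *: e k + p) - F p
      - \sum_(k <- s) phi k v * D k p| <= eps * `|v|.
Proof.
move=> dF cF; elim: s => [|k s IH] eps eps0.
  exists 1 => // v _; rewrite !big_nil add0r !subrr normr0.
  by rewrite mulr_ge0// ltW.
have eps20 : 0 < eps / 2 by rewrite divr_gt0.
have [r1 r10 H1] := strict_derive (dF k) (cF k) eps20.
have [r2 r20 H2] := IH _ eps20.
pose C := \sum_(k <- s) `|e k|.
have C0 : 0 < C + 1 by rewrite ltr_wpDl// /C sumr_ge0.
exists (Num.min (Num.min r1 r2) (r1 / (C + 1))).
  by rewrite !lt_min r10 r20 divr_gt0.
move=> v; rewrite !lt_min => /andP[/andP[vr1 vr2] vr3].
rewrite !big_cons -[X in F X - _]addrA; set q := (X in F (_ *: e k + X)).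
have qp : `|q - p| < r1.
  rewrite addrK (@le_lt_trans _ _ (`|v| * (C + 1)))//; last first.
    by rewrite -ltr_pdivlMr.
  rewrite (le_trans (ler_norm_sum _ _ _))// mulrDr mulr1 ler_wpDr//.
  by rewrite mulr_sumr ler_sum// => j _; rewrite normrZ ler_wpM2r.
have := H1 q (phi k v) qp (le_lt_trans (phi_le k v) vr1).
have := H2 v vr2; rewrite -/q.
move: (D k p) (\sum_(j <- s) _ * _) (F q) (F (_ + q)) => d S B A K2 K1.
rewrite (_ : A - F p - (phi k v * d + S) =
  (A - B - phi k v * d) + (B - F p - S)); last by ring.
rewrite (le_trans (ler_normD _ _))// (_ : eps * `|v| =
  eps / 2 * `|v| + eps / 2 * `|v|); last by field.
by rewrite lerD// (le_trans K1)// ler_wpM2l// ltW.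
Qed.

Lemma continuous_partials_differentiable F (D : I -> V -> R) p :
  (forall k, \forall q \near p, is_derive q (e k) F (D k q)) ->
  (forall k, {for p, continuous (D k)}) ->
  differentiable F p.
Proof.
move=> dF cF.
pose L := fun v : V => \sum_k phi k v * D k p : R^o.
have Llin : linear L.
  move=> a u v; rewrite /L scaler_sumr -big_split/=; apply: eq_bigr => k _.
  by rewrite phi_linear mulrDl scalerAl.
pose LM := GRing.isLinear.Build _ _ _ _ _ Llin.
pose LL : {linear V -> R^o} := HB.pack L LM.
have Lc : continuous LL.
  apply/linear_bounded_continuous/linear_boundedP.
  pose C := \sum_k `|D k p|.
  exists (C : R); split; first exact: num_real.
  move=> M CM x; apply: (@le_trans _ _ (C * `|x|)); last first.
    by rewrite ler_wpM2r// ltW.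
  rewrite /LL/= /L; apply: (le_trans (ler_norm_sum _ _ _)).
  rewrite mulr_suml ler_sum// => k _.
  by rewrite normrM mulrC ler_wpM2l.
have E : F \o shift p = cst (F p) + LL +o_ 0 id.
  apply/eqaddoP => eps eps0.
  have [r r0 H] := partials_expansion (index_enum I) dF cF eps0.
  near=> v.
  have vr : `|v| < r by near: v; exact: nbhs0_lt.
  have := H v vr; rewrite -phi_coord -addrA -opprD; exact.
apply/diff_locallyP; rewrite (diff_unique Lc E); split=> //.
Unshelve. all: by end_near. Qed.

End ContinuousPartials.

End Calculus.

Lemma derive0_cst_oo {R : realType} (f : R -> R) (a b : R) :
  (forall t, a < t < b -> is_derive t (1 : R) f 0) ->
  forall s t, a < s < b -> a < t < b -> f s = f t.
Proof.
move=> df s t; wlog st : s t / s <= t.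
  move=> H sab tab; case: (leP s t) => [|/ltW] le; first exact: H.
  by apply/esym/H.
move=> /andP[as_ _] /andP[_ tb]; apply/esym/eqP; rewrite -subr_eq0; apply/eqP.
have [||c _ ->] := @MVT_segment R f (cst 0) s t st; last by rewrite mul0r.
- move=> x /[!in_itv]/= /andP[sx xt]; apply: df.
  by rewrite (lt_trans as_ sx) (lt_trans xt tb).
- apply: derivable_within_continuous => x /[!in_itv]/= /andP[sx xt].
  have [] // := df x _.
  by rewrite (lt_le_trans as_ sx) (le_lt_trans xt tb).
Qed.

(** The end values of a curve that is continuous on a closed interval are
    recovered from its values inside; geodesic arcs are only differentiable in
    the interior. *)
Lemma within_eq_ends {R : realType} (f : R -> R) (l a b : R) : a < b ->
  {within `[a, b], continuous f} -> (forall t, a < t < b -> f t = l) ->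
  f a = l /\ f b = l.
Proof.
move=> ab cf fl.
have df t : t \in `]a, b[%R -> is_derive t (1 : R) f (cst 0 t).
  move=> tab; apply: (@near_eq_is_derive _ _ _ (cst l)) (is_derive_cst _ _ _).
  have := near_in_itvoo tab; apply: filterS => u /[!in_itv]/= /fl ->.
  by [].
have H x y : a <= x -> x <= y -> y <= b -> f y = f x.
  move=> ax xy yb; apply/eqP; rewrite -subr_eq0; apply/eqP.
  have dxy u : u \in `]x, y[%R -> is_derive u (1 : R) f (cst 0 u).
    rewrite in_itv/= => /andP[xu uy]; apply: df; rewrite in_itv/=.
    by rewrite (le_lt_trans ax xu) (lt_le_trans uy yb).
  have cxy : {within `[x, y], continuous f}.
    apply: continuous_subspaceW cf => u /=; rewrite !in_itv/= => /andP[xu uy].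
    by rewrite (le_trans ax xu) (le_trans uy yb).
  by have [c _ ->] := MVT_segment xy dxy cxy; rewrite mul0r.
have m1 : a < (a + b) / 2 by rewrite midf_lt.
have m2 : (a + b) / 2 < b by rewrite midf_lt.
have m : f ((a + b) / 2) = l by rewrite fl// m1.
by split; [rewrite -(H a _ _ (ltW m1) (ltW m2))|rewrite (H _ b (ltW m1) (ltW m2))].
Qed.

(** * Partial derivatives on the tangent bundle *)

Section Bundle.
Context {R : realType} {N : nat}.
Notation vec := ('rV[R]_N).
Implicit Types (f : vec -> vec -> R) (W : set (vec * vec)) (x y u v : vec).

Definition uncur f : vec * vec -> R := fun w => f w.1 w.2.

Lemma is_derive_pdx f x y i :
  derivable (fun x' => f x' y) x (base i) ->
  is_derive (x, y) (base i, 0) (uncur f) (pdx i f x y).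
Proof.
have E : (fun h : R => h^-1 *: (f (h *: base i + x) y - f x y)) =
  (fun h : R => h^-1 *: (uncur f (h *: (base i, 0) + (x, y)) - uncur f (x, y))).
  by apply/funext => h; rewrite /uncur/= scaler0 add0r.
by rewrite /pdx /pd /derive /derivable /= E => df; split.
Qed.

Lemma is_derive_pdy f x y i :
  derivable (f x) y (base i) ->
  is_derive (x, y) (0, base i) (uncur f) (pdy i f x y).
Proof.
have E : (fun h : R => h^-1 *: (f x (h *: base i + y) - f x y)) =
  (fun h : R => h^-1 *: (uncur f (h *: (0, base i) + (x, y)) - uncur f (x, y))).
  by apply/funext => h; rewrite /uncur/= scaler0 add0r.
by rewrite /pdy /pd /derive /derivable /= E => df; split.
Qed.

Lemma Cxy_cont p n W f w : Cxy p n W f -> W w -> {for w, continuous (uncur f)}.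
Proof. by case: n => [|n] [H _]; apply: H. Qed.

Lemma Cxy_sub p n W W' f : W' `<=` W -> Cxy p n W f -> Cxy p n W' f.
Proof.
move=> WW'; elim: n p f => [|n IH] p f [H1 H2]; split=> //.
- by move=> w /WW'; exact: H1.
- by move=> w /WW'; exact: H1.
case: H2 => H2 H3; split.
- case: p H2 {H1 H3} => // p H i; have [d c] := H i; split; last exact: IH.
  by move=> x y /WW'; exact: d.
- move=> k; have [d c] := H3 k; split; last exact: IH.
  by move=> x y /WW'; exact: d.
Qed.

Lemma Cxy_pdx p n W f i : Cxy p.+1 n.+1 W f -> Cxy p n W (pdx i f).
Proof. by case=> _ [/(_ i)[]]. Qed.

Lemma Cxy_pdy p n W f i : Cxy p n.+1 W f -> Cxy p n W (pdy i f).
Proof. by case=> _ [_ /(_ i)[]]. Qed.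

Lemma Cxy_is_derive_pdx p n W f i w : Cxy p.+1 n.+1 W f -> W w ->
  is_derive w (base i, 0) (uncur f) (uncur (pdx i f) w).
Proof. by case: w => x y [_ [/(_ i)[H _] _]] Wxy; apply/is_derive_pdx/H. Qed.

Lemma Cxy_is_derive_pdy p n W f i w : Cxy p n.+1 W f -> W w ->
  is_derive w (0, base i) (uncur f) (uncur (pdy i f) w).
Proof. by case: w => x y [_ [_ /(_ i)[H _]]] Wxy; apply/is_derive_pdy/H. Qed.

Lemma rV_le_norm (v : vec) i : `|v 0 i| <= `|v|.
Proof.
rewrite [leRHS]/Num.norm/= mx_normrE.
exact: (le_bigmax _ (fun j : 'I_1 * 'I_N => `|v j.1 j.2|) (0, i)).
Qed.

Lemma rV_base (v : vec) : v = \sum_i v 0 i *: base i.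
Proof. exact: row_sum_delta. Qed.

Definition pbase (k : 'I_N + 'I_N) : vec * vec :=
  match k with inl i => (base i, 0) | inr i => (0, base i) end.

Definition pcoord (k : 'I_N + 'I_N) (w : vec * vec) : R :=
  match k with inl i => w.1 0 i | inr i => w.2 0 i end.

Lemma pcoord_linear k : linear (pcoord k : vec * vec -> R^o).
Proof. by case: k => i a u v /=; rewrite !mxE. Qed.

Lemma pcoord_le k w : `|pcoord k w| <= `|w|.
Proof.
case: k => i /=; rewrite (le_trans (rV_le_norm _ _))//.
  by rewrite [leRHS]/Num.norm/= le_max lexx.
by rewrite [leRHS]/Num.norm/= le_max lexx orbT.
Qed.

Lemma pcoord_coord w : w = \sum_k pcoord k w *: pbase k.
Proof.
rewrite big_sumType/=; case: w => u v /=.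
have E1 (s : seq 'I_N) (a : vec) :
  \sum_(i <- s) a 0 i *: (base i, 0 : vec) = (\sum_(i <- s) a 0 i *: base i, 0 : vec).
  elim: s => [|i s IH]; first by rewrite !big_nil.
  by rewrite !big_cons IH; congr pair => /=; rewrite scaler0 addr0.
have E2 (s : seq 'I_N) (a : vec) :
  \sum_(i <- s) a 0 i *: (0 : vec, base i) = (0 : vec, \sum_(i <- s) a 0 i *: base i).
  elim: s => [|i s IH]; first by rewrite !big_nil.
  by rewrite !big_cons IH; congr pair => /=; rewrite scaler0 addr0.
by rewrite E1 E2 -!rV_base; congr pair => /=; rewrite ?addr0 ?add0r.
Qed.

Lemma Cxy_differentiable p n W f w : open W -> Cxy p.+1 n.+1 W f -> W w ->
  differentiable (uncur f) w.
Proof.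
move=> oW Cf Ww.
have nW : \forall q \near w, W q by exact: open_nbhs_nbhs.
apply: (continuous_partials_differentiable (D := fun k =>
    match k with inl i => uncur (pdx i f) | inr i => uncur (pdy i f) end)
    pcoord_linear pcoord_le pcoord_coord).
- case=> i; apply: filterS nW => q Wq.
    exact: Cxy_is_derive_pdx Cf Wq.
  exact: Cxy_is_derive_pdy Cf Wq.
- case=> i.
    exact: Cxy_cont (Cxy_pdx i Cf) Ww.
  exact: Cxy_cont (Cxy_pdy i Cf) Ww.
Qed.

Lemma Ck_differentiable n (U : set vec) (g : vec -> R) x : open U ->
  Ck n.+1 U g -> U x -> differentiable g x.
Proof.
move=> oU [_ Cg] Ux.
have nU : \forall q \near x, U q by exact: open_nbhs_nbhs.
apply: (@continuous_partials_differentiable R vec 'I_N base (fun i v => v 0 i) _ _ _ g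
  (fun i => pd i g)).
- by move=> i a u v; rewrite !mxE.
- by move=> i v; exact: rV_le_norm.
- exact: rV_base.
- by move=> i; apply: filterS nU => q Uq; have [H _] := Cg i; apply/derivableP/H.
- by move=> i; have [_] := Cg i; case: n {Cg} => [|n] [H _]; exact: H.
Qed.

Lemma diff_derive_pdx f i x y : differentiable (uncur f) (x, y) ->
  'D_(base i, 0) (uncur f) (x, y) = pdx i f x y.
Proof.
move=> df; apply: derive_val; apply: is_derive_pdx.
have /derivable1P : derivable (uncur f) (x, y) (base i, 0) by exact: diff_derivable.
rewrite /uncur/= => H; apply/derivable1P.
by move: H; under eq_fun do rewrite scaler0 add0r.
Qed.

Lemma diff_derive_pdy f i x y : differentiable (uncur f) (x, y) ->
  'D_(0, base i) (uncur f) (x, y) = pdy i f x y.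
Proof.
move=> df; apply: derive_val; apply: is_derive_pdy.
have /derivable1P : derivable (uncur f) (x, y) (0, base i) by exact: diff_derivable.
rewrite /uncur/= => H; apply/derivable1P.
by move: H; under eq_fun do rewrite scaler0 add0r.
Qed.

Lemma derive_partials f x y u v : differentiable (uncur f) (x, y) ->
  'D_(u, v) (uncur f) (x, y) =
  \sum_k u 0 k * pdx k f x y + \sum_k v 0 k * pdy k f x y.
Proof.
move=> df; rewrite deriveE// [in LHS](pcoord_coord (u, v)) linear_sum.
rewrite big_sumType/=; congr (_ + _); apply: eq_bigr => k _.
  by rewrite linearZ/= -(deriveE (base k, 0 : vec) df) diff_derive_pdx.
by rewrite linearZ/= -(deriveE (0 : vec, base k) df) diff_derive_pdy.
Qed.

(** [d_i] is the derivative in the direction [(e_i, N_i)] of the total space;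
    this turns the rules for [d_i] into rules for directional derivatives. *)
Lemma dop_derive (Nc : 'I_N -> 'I_N -> vec -> vec -> R) i f x y :
  differentiable (uncur f) (x, y) ->
  is_derive (x, y) (base i, \row_k Nc k i x y) (uncur f) (dop Nc i f x y).
Proof.
move=> df; split; first exact: diff_derivable.
rewrite derive_partials// /dop; congr (_ + _); last first.
  by apply: eq_bigr => k _; rewrite mxE.
rewrite (bigD1 i)//= big1 ?addr0 ?mxE ?eqxx ?mul1r// => k ki.
by rewrite mxE eqxx/= (negPf ki) mul0r.
Qed.

Lemma pdx_pdy p n W f i k x y : open W -> Cxy p.+1 n.+2 W f -> W (x, y) ->
  pdy k (pdx i f) x y = pdx i (pdy k f) x y.
Proof.
move=> oW Cf Ww.
have nW : \forall q \near (x, y), W q by exact: open_nbhs_nbhs.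
apply: (@schwarz R _ (uncur f) (uncur (pdx i f)) (uncur (pdy k f))
  (uncur (pdy k (pdx i f))) (uncur (pdx i (pdy k f))) (x, y) (base i, 0) (0, base k)).
- apply: filterS nW => q Wq; split.
  + exact: Cxy_is_derive_pdx Cf Wq.
  + exact: Cxy_is_derive_pdy Cf Wq.
  + exact: Cxy_is_derive_pdy (Cxy_pdx i Cf) Wq.
  + exact: Cxy_is_derive_pdx (Cxy_pdy k Cf) Wq.
- exact: Cxy_cont (Cxy_pdy k (Cxy_pdx i Cf)) Ww.
- exact: Cxy_cont (Cxy_pdx i (Cxy_pdy k Cf)) Ww.
Qed.

Lemma pdy_pdy p n W f k l x y : open W -> Cxy p n.+2 W f -> W (x, y) ->
  pdy k (pdy l f) x y = pdy l (pdy k f) x y.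
Proof.
move=> oW Cf Ww.
have nW : \forall q \near (x, y), W q by exact: open_nbhs_nbhs.
apply: (@schwarz R _ (uncur f) (uncur (pdy l f)) (uncur (pdy k f))
  (uncur (pdy k (pdy l f))) (uncur (pdy l (pdy k f))) (x, y) (0, base l) (0, base k)).
- apply: filterS nW => q Wq; split.
  + exact: Cxy_is_derive_pdy Cf Wq.
  + exact: Cxy_is_derive_pdy Cf Wq.
  + exact: Cxy_is_derive_pdy (Cxy_pdy l Cf) Wq.
  + exact: Cxy_is_derive_pdy (Cxy_pdy k Cf) Wq.
- exact: Cxy_cont (Cxy_pdy k (Cxy_pdy l Cf)) Ww.
- exact: Cxy_cont (Cxy_pdy l (Cxy_pdy k Cf)) Ww.
Qed.

Lemma is_derive_bundle (V : normedModType R) (X Y : V -> vec) (q v : V) d1 d2 f :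
  is_derive q v X d1 -> is_derive q v Y d2 -> differentiable (uncur f) (X q, Y q) ->
  is_derive q v (fun q => f (X q) (Y q))
   (\sum_k d1 0 k * pdx k f (X q) (Y q) + \sum_k d2 0 k * pdy k f (X q) (Y q)).
Proof.
move=> /is_derive_line[dX eX] /is_derive_line[dY eY] df; apply/is_derive_line.
rewrite -derive_partials//.
have {}dX := (derivable1_diffP _ _).1 dX.
have {}dY := (derivable1_diffP _ _).1 dY.
rewrite deriveE// in eX; rewrite deriveE// in eY.
pose G (t : R) := (X (t *: v + q), Y (t *: v + q)).
have dG : differentiable G 0 by exact: differentiable_pair.
have G0 : G 0 = (X q, Y q) by rewrite /G scale0r add0r.
have dfG : differentiable (uncur f) (G 0) by rewrite G0.
have dC : differentiable (uncur f \o G) 0 by exact: differentiable_comp.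
have EG : 'd G 0 1 = (d1, d2).
  rewrite -eX -eY; exact: (congr1 (fun g : R -> _ => g 1) (diff_pair dX dY)).
have EC : 'd (uncur f \o G) 0 1 = 'd (uncur f) (G 0) ('d G 0 1).
  exact: (congr1 (fun g : R -> _ => g 1) (diff_comp dG dfG)).
have -> : 'D_(d1, d2) (uncur f) (X q, Y q) = 'D_1 (uncur f \o G) 0.
  by rewrite (deriveE _ dC) EC EG G0 (deriveE _ df).
by apply/derivableP; apply: diff_derivable.
Qed.

End Bundle.

(** * Leibniz rules *)

Section DeriveRules.
Context {R : realType} {V : normedModType R}.
Implicit Types (p v : V).

Lemma is_derive_mul p v (f g : V -> R) df dg :
  is_derive p v f df -> is_derive p v g dg ->
  is_derive p v (fun q => f q * g q) (df * g p + f p * dg).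
Proof.
move=> Hf Hg; apply: (is_derive_eq (is_deriveM Hf Hg)).
by rewrite /= addrC [g p *: _]mulrC.
Qed.

Lemma is_derive_bigsum n p v (f : 'I_n -> V -> R) (df : 'I_n -> R) :
  (forall k, is_derive p v (f k) (df k)) ->
  is_derive p v (fun q => \sum_k f k q) (\sum_k df k).
Proof.
move=> H; rewrite (_ : (fun q => _) = \sum_k f k); last first.
  by apply/funext => q; rewrite fct_sumE.
exact: is_derive_sum.
Qed.

Lemma derivable_bigsum n p v (f : 'I_n -> V -> R) :
  (forall k, derivable (f k) p v) -> derivable (fun q => \sum_k f k q) p v.
Proof.
by move=> H; have [] := is_derive_bigsum (fun k => derivableP (H k)).
Qed.

Lemma is_derive_mx p v m n (X : V -> 'M[R]_(m, n)) (d : 'M[R]_(m, n)) :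
  is_derive p v X d <-> forall i j, is_derive p v (fun q => X q i j) (d i j).
Proof.
split=> [[dX eX] i j|H].
  split; first by move/derivable_mxP: dX.
  by rewrite -eX derive_mx// mxE.
have dX : derivable X p v by apply/derivable_mxP => i j; have [] := H i j.
split=> //; rewrite derive_mx//; apply/matrixP => i j; rewrite mxE.
by have [] := H i j.
Qed.

Lemma near_eq_differentiable (W : normedModType R) (f g : V -> W) p :
  (\forall q \near p, f q = g q) -> differentiable f p -> differentiable g p.
Proof.
move=> fg df; have fgp : f p = g p := nbhs_singleton fg.
have E : g \o shift p = cst (g p) + 'd f p +o_ 0 id.
  apply/eqaddoP => eps eps0.
  have /eqaddoP/(_ _ eps0) := diff_locally df.
  have : \forall q \near (0 : V), f (q + p) = g (q + p).
    by have := fg; rewrite (near_shift 0); apply: filterS => q /=; rewrite subr0.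
  apply: filterS2 => q fgq; rewrite fgp.
  suff -> : (f \o shift p - (cst (g p) + 'd f p)) q =
     (g \o shift p - (cst (g p) + 'd f p)) q by [].
  by rewrite !fctE /= fgq.
apply/diff_locallyP; rewrite (diff_unique (diff_continuous df) E).
by split; [exact: diff_continuous|exact: E].
Qed.

Lemma differentiable_bigsum n p (f : 'I_n -> V -> R) :
  (forall k, differentiable (f k) p) -> differentiable (fun q => \sum_k f k q) p.
Proof.
move=> H; rewrite (_ : (fun q => _) = \sum_k f k); last first.
  by apply/funext => q; rewrite fct_sumE.
exact: differentiable_sum.
Qed.

Lemma differentiable_real p (f : R -> R) (g : V -> R) df :
  is_derive (g p) (1 : R) f df -> differentiable g p ->
  differentiable (fun q => f (g q)) p.
Proof.
move=> [/derivable1_diffP Hf _] Hg.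
exact: (@differentiable_comp _ _ _ _ g f).
Qed.

End DeriveRules.

(** * Bilinear forms *)

Section BilinearForms.
Context {R : realType} {N : nat}.
Notation vec := ('rV[R]_N).
Implicit Types (A B : 'M[R]_N) (u v w : vec).

Definition bil A u v : R := \sum_m \sum_n A m n * u 0 m * v 0 n.

Lemma bilE A u v : bil A u v = (u *m A *m v^T) 0 0.
Proof.
rewrite /bil mxE exchange_big; apply: eq_bigr => n _.
rewrite !mxE mulr_suml; apply: eq_bigr => m _.
by rewrite [u 0 m * _]mulrC.
Qed.

Lemma bilDl A u v w : bil A (u + v) w = bil A u w + bil A v w.
Proof. by rewrite !bilE !mulmxDl mxE. Qed.

Lemma bilDr A u v w : bil A u (v + w) = bil A u v + bil A u w.
Proof. by rewrite !bilE linearD/= mulmxDr mxE. Qed.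

Lemma bilZl A (k : R) u v : bil A (k *: u) v = k * bil A u v.
Proof. by rewrite !bilE -!scalemxAl mxE. Qed.

Lemma bilZr A (k : R) u v : bil A u (k *: v) = k * bil A u v.
Proof. by rewrite !bilE linearZ/= -scalemxAr mxE. Qed.

Lemma bilNl A u v : bil A (- u) v = - bil A u v.
Proof. by rewrite -scaleN1r bilZl mulN1r. Qed.

Lemma bilNr A u v : bil A u (- v) = - bil A u v.
Proof. by rewrite -scaleN1r bilZr mulN1r. Qed.

Lemma bilBl A u v w : bil A (u - v) w = bil A u w - bil A v w.
Proof. by rewrite bilDl bilNl. Qed.

Lemma bilBr A u v w : bil A u (v - w) = bil A u v - bil A u w.
Proof. by rewrite bilDr bilNr. Qed.

Lemma bil0l A u : bil A 0 u = 0.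
Proof. by rewrite -(scale0r 0) bilZl mul0r. Qed.

Lemma bil_suml n A (c : 'I_n -> R) (u : 'I_n -> vec) v :
  bil A (\sum_k c k *: u k) v = \sum_k c k * bil A (u k) v.
Proof.
rewrite bilE !mulmx_suml summxE; apply: eq_bigr => k _.
by rewrite -bilZl bilE.
Qed.

Lemma bilC A u v : A^T = A -> bil A u v = bil A v u.
Proof.
move=> As; rewrite !bilE -[in LHS](trmxK (u *m A *m v^T)) [LHS]mxE.
by rewrite !trmx_mul trmxK As mulmxA.
Qed.

Lemma bil_sumr n A (c : 'I_n -> R) (u : 'I_n -> vec) v :
  bil A v (\sum_k c k *: u k) = \sum_k c k * bil A v (u k).
Proof.
rewrite bilE (linear_sum trmx) mulmx_sumr summxE; apply: eq_bigr => k _.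
by rewrite -bilZr bilE.
Qed.

Lemma is_derive_bil (V : normedModType R) (p q : V) (A : V -> 'M[R]_N)
    (u v : V -> vec) A' u' v' :
  is_derive p q A A' -> is_derive p q u u' -> is_derive p q v v' ->
  is_derive p q (fun t => bil (A t) (u t) (v t))
    (bil A' (u p) (v p) + bil (A p) u' (v p) + bil (A p) (u p) v').
Proof.
move=> /is_derive_mx dA /is_derive_mx du /is_derive_mx dv.
have D m n := is_derive_mul (is_derive_mul (dA m n) (du 0 m)) (dv 0 n).
apply: (is_derive_eq (is_derive_bigsum (fun m => is_derive_bigsum (D m)))).
rewrite /= /bil -!big_split; apply: eq_bigr => m _.
rewrite -!big_split; apply: eq_bigr => n _ /=; ring.
Qed.

Lemma differentiable_bil (V : normedModType R) (p : V) (A : V -> 'M[R]_N)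
    (u v : V -> vec) :
  (forall m n, differentiable (fun q => A q m n) p) ->
  (forall m, differentiable (fun q => u q 0 m) p) ->
  (forall m, differentiable (fun q => v q 0 m) p) ->
  differentiable (fun q => bil (A q) (u q) (v q)) p.
Proof.
move=> dA du dv; apply: differentiable_bigsum => m.
apply: differentiable_bigsum => n; apply: differentiableM => //.
exact: differentiableM.
Qed.

Definition posdef A := forall v, v != 0 -> 0 < bil A v v.

Lemma posdef_unit A : posdef A -> A \in unitmx.
Proof.
move=> pA; rewrite -row_free_unit -kermx_eq0; apply/eqP/row_matrixP => i.
rewrite row0; apply/eqP/negP => /negP/pA; rewrite bilE -row_mul mulmx_ker row0.
by rewrite mul0mx mxE ltxx.
Qed.

Lemma posdef_ge0 A v : posdef A -> 0 <= bil A v v.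
Proof.
move=> pA; have [->|/pA/ltW//] := eqVneq v 0; by rewrite bil0l.
Qed.

Lemma posdef_eq0 A v : posdef A -> bil A v v = 0 -> v = 0.
Proof.
by move=> pA v0; apply/eqP/negP => /negP/pA; rewrite v0 ltxx.
Qed.

End BilinearForms.

(** * The Levi-Civita connection *)

Section LeviCivita.
Context {R : realType} {N : nat}.
Notation vec := ('rV[R]_N).
Variables (U : set vec) (a : vec -> 'M[R]_N).
Hypothesis oU : open U.
Hypothesis a_reg : forall i j, Ck 4 U (fun x => a x i j).
Hypothesis a_sym : forall x, U x -> (a x)^T = a x.
Hypothesis a_pos : forall x, U x -> posdef (a x).

(** The matrix part of the connection: [nabla_i u = d_i u + conn x i u]. *)
Definition conn x i (u : vec) : vec :=
  \row_p \sum_m christoffel a p m i x * u 0 m.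

Definition dmetric i x : 'M[R]_N := \matrix_(m, n) pd i (fun x' => a x' m n) x.

Lemma conn_is_linear x i : linear (conn x i).
Proof.
move=> k u v; apply/rowP => p; rewrite !mxE mulr_sumr -big_split.
by apply: eq_bigr => m _; rewrite !mxE /=; ring.
Qed.

HB.instance Definition _ x i :=
  GRing.isLinear.Build R vec vec _ (conn x i) (@conn_is_linear x i).

Lemma dmetric_sym i x m n : U x ->
  pd i (fun x' => a x' m n) x = pd i (fun x' => a x' n m) x.
Proof.
move=> Ux; apply: near_eq_derive.
have nU : \forall q \near x, U q by exact: open_nbhs_nbhs.
by apply: filterS nU => q Uq; rewrite -{1}(a_sym Uq) mxE.
Qed.

(** [nabla a = 0].  Lowering the upper index of the Christoffel symbols leaves
    the symbols of the first kind, whose sum over the two orders of the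
    remaining indices is [d_i a]. *)
Lemma metricity x i u v : U x ->
  bil (dmetric i x) u v = bil (a x) (conn x i u) v + bil (a x) u (conn x i v).
Proof.
move=> Ux.
pose G := \matrix_(p, m) christoffel a p m i x.
have GE w : conn x i w = w *m G^T.
  by apply/rowP => p; rewrite !mxE; apply: eq_bigr => m _; rewrite !mxE mulrC.
pose X := \matrix_(l, m) ((pd m (fun x' => a x' l i) x + pd i (fun x' => a x' l m) x
     - pd l (fun x' => a x' m i) x) / 2).
have AG : a x *m G = X.
  have -> : G = invmx (a x) *m X.
    apply/matrixP => p m; rewrite !mxE; apply: eq_bigr => l _.
    by rewrite !mxE mulrA.
  by rewrite mulKVmx// posdef_unit//; exact: a_pos.
have dA : dmetric i x = (a x *m G)^T + a x *m G.
  rewrite AG; apply/matrixP => m n; rewrite !mxE.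
  rewrite (dmetric_sym i n m Ux) (dmetric_sym m n i Ux) (dmetric_sym n m i Ux).
  rewrite [pd m _ x](dmetric_sym m _ _ Ux) [pd n _ x](dmetric_sym n _ _ Ux).
  lra.
rewrite dA trmx_mul a_sym// !bilE !GE trmx_mul trmxK !mulmxA.
by rewrite mulmxDr mulmxDl mxE !mulmxA.
Qed.

Lemma is_derive_metric x i : U x -> is_derive x (base i) a (dmetric i x).
Proof.
move=> Ux; apply/is_derive_mx => m n; rewrite mxE; apply/derivableP.
apply: diff_derivable; exact: (Ck_differentiable oU (a_reg m n)).
Qed.

Lemma is_derive_fst (V W Z : normedModType R) (f : V -> Z) x (y : W) v w d :
  is_derive x v f d -> is_derive (x, y) (v, w) (fun q => f q.1) d.
Proof. by move=> /is_derive_line H; apply/is_derive_line. Qed.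

Lemma differentiable_fst_comp (V W Z : normedModType R) (f : V -> Z) x (y : W) :
  differentiable f x -> differentiable (fun q : V * W => f q.1) (x, y).
Proof.
move=> df; apply: (@differentiable_comp _ _ _ _ fst f) => //.
by apply: (linear_differentiable (f := fst)); move=> q; exact: cvg_fst.
Qed.

End LeviCivita.

(** * Restriction to a fibre and to a base direction *)

Section Slices.
Context {R : realType} {N : nat}.
Notation vec := ('rV[R]_N).
Implicit Types (W : set (vec * vec)) (f : vec -> vec -> R) (x y v : vec).

Lemma near_fiber W x y : open W -> W (x, y) -> \forall y' \near y, W (x, y').
Proof.
move=> oW Wxy; have /nbhs_ballP[e /= e0 He] : nbhs (x, y) W.
  exact: open_nbhs_nbhs.
apply/nbhs_ballP; exists e => //= y' yy'; apply: He.
by split => //=; exact: ballxx.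
Qed.

Lemma near_base W x y : open W -> W (x, y) -> \forall x' \near x, W (x', y).
Proof.
move=> oW Wxy; have /nbhs_ballP[e /= e0 He] : nbhs (x, y) W.
  exact: open_nbhs_nbhs.
apply/nbhs_ballP; exists e => //= x' xx'; apply: He.
by split => //=; exact: ballxx.
Qed.

Lemma Cxy_derive_fiber p n W f k x y : Cxy p n.+1 W f -> W (x, y) ->
  is_derive y (base k) (f x) (pdy k f x y).
Proof. by move=> [_ [_ /(_ k)[H _]]] Wxy; apply/derivableP/H. Qed.

Lemma Cxy_derive_base p n W f i x y : Cxy p.+1 n.+1 W f -> W (x, y) ->
  is_derive x (base i) (fun x' => f x' y) (pdx i f x y).
Proof. by move=> [_ [/(_ i)[H _] _]] Wxy; apply/derivableP/H. Qed.

Lemma is_derive_fiber f x y v : differentiable (uncur f) (x, y) ->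
  is_derive y v (f x) (\sum_k v 0 k * pdy k f x y).
Proof.
move=> df; have := is_derive_bundle (is_derive_cst x y v) (is_derive_id y v) df.
move/is_derive_eq; apply.
by rewrite big1 ?add0r// => k _; rewrite mxE mul0r.
Qed.

Lemma is_derive_uniq (V W : normedModType R) (F : V -> W) (p v : V) (a b : W) :
  is_derive p v F a -> is_derive p v F b -> a = b.
Proof. by move=> [_ <-] [_ <-]. Qed.

Lemma euler f x y (k : R) : differentiable (uncur f) (x, y) ->
  (forall gam : R, 0 < gam -> f x (gam *: y) = gam `^ k * f x y) ->
  \sum_l y 0 l * pdy l f x y = k * f x y.
Proof.
move=> df hf; have /is_derive_line D1 := is_derive_fiber y df.
apply: (is_derive_uniq D1).
have D2 : is_derive (0 : R) (1 : R) (fun t : R => (t + 1) `^ k * f x y) (k * f x y).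
  have P : is_derive ((0 : R) + 1) (1 : R) (fun t : R => t `^ k) (k * (0 + 1) `^ (k - 1)).
    by apply: is_derive1_powR; rewrite add0r.
  have Q : is_derive (0 : R) (1 : R) (fun t : R => t + 1) (1 + 0).
    exact: is_deriveD.
  have := is_derive_mul
    (@is_derive1_comp R (fun t => t `^ k) (fun t => t + 1) 0 _ _ P Q) (is_derive_cst (f x y) (0 : R) (1 : R)).
  by move/is_derive_eq; apply; rewrite add0r powR1 mulr0 !addr0 !mulr1.
apply: near_eq_is_derive D2.
have : \forall t \near (0 : R), -1 < t by apply: lt_nbhsr; rewrite ltrN10.
apply: filterS => t t1; rewrite -hf ?scalerDl ?scale1r//.
by rewrite -ltrBlDr sub0r.
Qed.

End Slices.

(** The coordinate expressions, in one chart with image [U], of a conformally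
    isomorphic pair of spaces. *)
Record local_conformal {R : realType} {N : nat} (U : set 'rV[R]_N)
    (K : 'rV[R]_N -> 'rV[R]_N -> R) (a : 'rV[R]_N -> 'M[R]_N)
    (D E : set ('rV[R]_N * 'rV[R]_N))
    (zeta eta : 'rV[R]_N -> 'rV[R]_N -> 'rV[R]_N) (h : R) : Prop :=
  LocalConformal {
  lc_openU : open U;
  lc_openD : open D;
  lc_openE : open E;
  lc_DU : forall x y, D (x, y) -> U x;
  lc_Dcone : forall x y (gam : R), 0 < gam -> D (x, y) -> D (x, gam *: y);
  lc_Econe : forall x z (gam : R), 0 < gam -> E (x, z) -> E (x, gam *: z);
  lc_to : forall x y, D (x, y) -> E (x, zeta x y) /\ eta x (zeta x y) = y;
  lc_from : forall x z, E (x, z) -> D (x, eta x z) /\ zeta x (eta x z) = z;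
  lc_zeta : forall i, Cxy 4 5 D (fun x y => zeta x y 0 i);
  lc_eta : forall i, Cxy 4 5 E (fun x z => eta x z 0 i);
  lc_K : Cxy 4 5 D K;
  lc_Kgt0 : forall x y, D (x, y) -> 0 < K x y;
  lc_Khom : forall x y (gam : R), D (x, y) -> 0 < gam ->
    K x (gam *: y) = gam * K x y;
  lc_a : forall i j, Ck 4 U (fun x => a x i j);
  lc_sym : forall x, U x -> (a x)^T = a x;
  lc_pos : forall x, U x -> posdef (a x);
  lc_h : 0 < h;
  lc_hom : forall x y (gam : R), D (x, y) -> 0 < gam ->
    zeta x (gam *: y) = gam `^ h *: zeta x y;
  lc_unit : forall x y, D (x, y) -> (K x y = 1 <-> Snorm a x (zeta x y) = 1);
  lc_metric : forall x y m n, D (x, y) -> gten K m n x y =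
    (h^-1 * K x y `^ (1 - h)) ^+ 2 *
    \sum_i \sum_j zetad zeta i m x y * zetad zeta j n x y * a x i j
}.

(** * Parallel transport of the image vector *)

Section Local.
Context {R : realType} {N : nat}.
Notation vec := ('rV[R]_N).
Variables (U : set vec) (K : vec -> vec -> R) (a : vec -> 'M[R]_N)
  (D E : set (vec * vec)) (zeta eta : vec -> vec -> vec) (h : R).
Hypothesis L : local_conformal U K a D E zeta eta h.
Implicit Types (x y z u v w : vec) (i j k l m n : 'I_N).

Let oD := lc_openD L.
Let oE := lc_openE L.
Let Nc := Nco zeta eta a.
Local Notation zc j := (fun x y => zeta x y 0 j).

(** The image of the coordinate vector [e_n] under the differential of
    [zeta x] at [y]. *)
Definition frame n x y : vec := \row_j zetad zeta j n x y.

Lemma zeta_diff j x y : D (x, y) -> differentiable (uncur (zc j)) (x, y).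
Proof. exact: Cxy_differentiable oD (lc_zeta L j). Qed.

Lemma zetad_diff j k x y : D (x, y) -> differentiable (uncur (zetad zeta j k)) (x, y).
Proof. exact: Cxy_differentiable oD (Cxy_pdy k (lc_zeta L j)). Qed.

Lemma eta_diff j x z : E (x, z) -> differentiable (uncur (fun x z => eta x z 0 j)) (x, z).
Proof. exact: Cxy_differentiable oE (lc_eta L j). Qed.

Lemma K_diff x y : D (x, y) -> differentiable (uncur K) (x, y).
Proof. exact: Cxy_differentiable oD (lc_K L). Qed.

(** Derivative of [zeta x (eta x z) = z] in [z]. *)
Lemma frame_zeta_eta j l x y : D (x, y) ->
  \sum_k zetad zeta j k x y * yinvd zeta eta k l x y = (j == l)%:R.
Proof.
move=> Dxy; have [Exz ez] := lc_to L Dxy; set z := zeta x y in Exz ez *.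
pose d : vec := \row_k yinvd zeta eta k l x y.
have deta : is_derive z (base l) (eta x) d.
  apply/is_derive_mx => i k; rewrite ord1 mxE.
  exact: (Cxy_derive_fiber l (lc_eta L k)).
have dz : differentiable (uncur (zc j)) (x, eta x z) by rewrite ez; exact: zeta_diff.
have H := is_derive_bundle (is_derive_cst x z (base l)) deta dz.
have H' : is_derive z (base l) (fun z' => zeta x (eta x z') 0 j) (base l 0 j).
  apply: (@near_eq_is_derive _ _ _ (fun z' : vec => z' 0 j)).
    apply: filterS (near_fiber oE Exz) => z' Exz'.
    by have [_ ->] := lc_from L Exz'.
  by have /is_derive_mx := is_derive_id z (base l); apply.
have := is_derive_uniq H H'; rewrite /= ez => E1.
rewrite -[RHS](_ : base l 0 j = _); last by rewrite mxE eqxx.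
rewrite -E1 [X in _ = X + _]big1 ?add0r; last by move=> k _; rewrite mxE mul0r.
by apply: eq_bigr => k _; rewrite mxE mulrC.
Qed.

Lemma frame_eta_zeta k l x y : D (x, y) ->
  \sum_j yinvd zeta eta k j x y * zetad zeta j l x y = (k == l)%:R.
Proof.
move=> Dxy.
pose Z := \matrix_(j, k) zetad zeta j k x y.
pose Y := \matrix_(k, l) yinvd zeta eta k l x y.
have ZY : Z *m Y = 1%:M.
  apply/matrixP => i j; rewrite !mxE -(frame_zeta_eta i j Dxy).
  by apply: eq_bigr => r _; rewrite !mxE.
have := mulmx1C ZY => /matrixP/(_ k l); rewrite !mxE => <-.
by apply: eq_bigr => r _; rewrite !mxE.
Qed.

(** The coefficients [N] are built from the inverse Jacobian of [zeta x]
    precisely to solve this linear system. *)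
Lemma zeta_transport i j x y : D (x, y) ->
  pdx i (zc j) x y + \sum_k Nc k i x y * zetad zeta j k x y
  = - conn a x i (zeta x y) 0 j.
Proof.
move=> Dxy; pose T l := pdx i (zc l) x y + \sum_m christoffel a l m i x * zeta x y 0 m.
have -> : \sum_k Nc k i x y * zetad zeta j k x y = - T j; last first.
  by rewrite /T opprD addrA subrr add0r mxE.
transitivity (\sum_k \sum_l - (zetad zeta j k x y * yinvd zeta eta k l x y) * T l).
  apply: eq_bigr => k _; rewrite /Nc /Nco mulNr mulr_suml -sumrN.
  by apply: eq_bigr => l _; rewrite -/(T l); ring.
rewrite exchange_big/= (bigD1 j)//= [X in _ + X]big1 ?addr0 => [|l /negPf lj].
  by rewrite -mulr_suml sumrN frame_zeta_eta// eqxx mulN1r.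
by rewrite -mulr_suml sumrN frame_zeta_eta// eq_sym lj oppr0 mul0r.
Qed.

Lemma Nc_derivable k i n x y : D (x, y) -> derivable (Nc k i x) y (base n).
Proof.
move=> Dxy.
rewrite /Nc /Nco; apply: derivableN.
apply: derivable_bigsum => l.
apply: derivableM; last apply: derivableD.
- have [Exz ez] := lc_to L Dxy.
  have dz : is_derive y (base n) (zeta x) (frame n x y).
    apply/is_derive_mx => r j; rewrite ord1 mxE.
    exact: (Cxy_derive_fiber n (lc_zeta L j)).
  have de : differentiable (uncur (pdy l (fun x z => eta x z 0 k))) (x, zeta x y).
    exact: Cxy_differentiable oE (Cxy_pdy l (lc_eta L k)) Exz.
  by have [] := is_derive_bundle (is_derive_cst x y (base n)) dz de.
- by have [] := Cxy_derive_fiber n (Cxy_pdx i (lc_zeta L l)) Dxy.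
- apply: derivable_bigsum => m.
  apply: derivableM; first exact: derivable_cst.
  by have [] := Cxy_derive_fiber n (lc_zeta L m) Dxy.
Qed.

End Local.

(** * The vanishing set and the metricity *)

Section Metricity.
Context {R : realType} {N : nat}.
Notation vec := ('rV[R]_N).
Variables (U : set vec) (K : vec -> vec -> R) (a : vec -> 'M[R]_N)
  (D E : set (vec * vec)) (zeta eta : vec -> vec -> vec) (h : R).
Hypothesis L : local_conformal U K a D E zeta eta h.
Implicit Types (x y z u v w : vec) (i j k l m n : 'I_N).

Let oU := lc_openU L.
Let oD := lc_openD L.
Let Nc := Nco zeta eta a.
Local Notation zc j := (fun x y => zeta x y 0 j).

(** The transport identity for [zeta] differentiated in [y^n]: the derivative
    of [N] produces the [D]-term. *)
Lemma zetad_transport i j n x y : D (x, y) ->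
  dop Nc i (zetad zeta j n) x y =
  - conn a x i (frame zeta n x y) 0 j + \sum_k Dco Nc k i n x y * zetad zeta j k x y.
Proof.
move=> Dxy.
have dF := is_deriveD (Cxy_derive_fiber n (Cxy_pdx i (lc_zeta L j)) Dxy)
  (is_derive_bigsum (fun k => is_derive_mul
     (derivableP (Nc_derivable (k := k) (i := i) (n := n) L Dxy))
     (Cxy_derive_fiber n (Cxy_pdy k (lc_zeta L j)) Dxy))).
have dG := is_deriveN (is_derive_bigsum (fun m => is_derive_mul
     (is_derive_cst (christoffel a j m i x) y (base n))
     (Cxy_derive_fiber n (lc_zeta L m) Dxy))).
have {}dF := near_eq_is_derive _ dF.
have FG : \forall y' \near y, pdx i (zc j) x y' +
    \sum_k Nc k i x y' * zetad zeta j k x y' =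
    - \sum_m christoffel a j m i x * zeta x y' 0 m.
  by apply: filterS (near_fiber oD Dxy) => y' D'; rewrite (zeta_transport L)// mxE.
have := is_derive_uniq (dF _ FG) dG.
rewrite /dop -(pdx_pdy i n oD (lc_zeta L j) Dxy).
under eq_bigr do rewrite -(pdy_pdy _ n oD (lc_zeta L j) Dxy).
rewrite big_split/= addrCA => E1; rewrite mxE.
under [X in - X]eq_bigr do rewrite mxE.
move: E1; under [X in _ = - X]eq_bigr do rewrite mul0r add0r.
move=> <-; have -> : \sum_k Dco Nc k i n x y * zetad zeta j k x y =
    - \sum_k pdy n (Nc k i) x y * zetad zeta j k x y.
  by rewrite -sumrN; apply: eq_bigr => k _; rewrite /Dco mulNr.
by rewrite [LHS]addrC -addrA addrC; ring.
Qed.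

Lemma zeta_euler j x y : D (x, y) ->
  \sum_l y 0 l * zetad zeta j l x y = h * zeta x y 0 j.
Proof.
move=> Dxy; apply: (euler (zeta_diff L j Dxy)) => gam gam0.
by rewrite (lc_hom L Dxy gam0) mxE.
Qed.

(** The derivatives of [zeta^j] in [x^i] and [y^r] satisfy Euler identities of
    degrees [h] and [h - 1]; contracting [zetad_transport] with [y] then shows
    that the defect of homogeneity of [N] is annihilated by the invertible
    Jacobian of [zeta x]. *)
Lemma Nc_euler k i x y : D (x, y) ->
  \sum_l y 0 l * pdy l (Nc k i) x y = Nc k i x y.
Proof.
move=> Dxy.
have E1 j : \sum_l y 0 l * pdy l (pdx i (zc j)) x y = h * pdx i (zc j) x y.
  have d1 : is_derive x (base i) (fun x' => \sum_l y 0 l * zetad zeta j l x' y)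
      (\sum_l (0 * zetad zeta j l x y + y 0 l * pdx i (zetad zeta j l) x y)).
    apply: is_derive_bigsum => l; apply: is_derive_mul.
    exact: (Cxy_derive_base i (Cxy_pdy l (lc_zeta L j))).
  have d2 := is_derive_mul (is_derive_cst h x (base i))
    (Cxy_derive_base i (lc_zeta L j) Dxy).
  have ne : \forall x' \near x,
      h * zeta x' y 0 j = \sum_l y 0 l * zetad zeta j l x' y.
    by apply: filterS (near_base oD Dxy) => x' D'; rewrite zeta_euler.
  have := is_derive_uniq (near_eq_is_derive ne d2) d1; rewrite mul0r add0r => ->; apply: eq_bigr => l _.
  by rewrite mul0r add0r (pdx_pdy i l oD (lc_zeta L j) Dxy).
have E2 j r : \sum_l y 0 l * pdy l (zetad zeta j r) x y =
    (h - 1) * zetad zeta j r x y.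
  have d1 : is_derive y (base r) (fun y' : vec => \sum_l y' 0 l * zetad zeta j l x y')
      (\sum_l (base r 0 l * zetad zeta j l x y + y 0 l * pdy r (zetad zeta j l) x y)).
    apply: is_derive_bigsum => l; apply: is_derive_mul.
      by have /is_derive_mx := is_derive_id y (base r); apply.
    exact: (Cxy_derive_fiber r (Cxy_pdy l (lc_zeta L j))).
  have d2 := is_derive_mul (is_derive_cst h y (base r))
    (Cxy_derive_fiber r (lc_zeta L j) Dxy).
  have ne : \forall y' \near y,
      h * zeta x y' 0 j = \sum_l y' 0 l * zetad zeta j l x y'.
    by apply: filterS (near_fiber oD Dxy) => y' D'; rewrite zeta_euler.
  have := is_derive_uniq (near_eq_is_derive ne d2) d1; rewrite mul0r add0r big_split/= (bigD1 r)//= [X in _ + X + _]big1; last first.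
    by move=> l /negPf lr; rewrite mxE lr andbF mul0r.
  rewrite mxE !eqxx mul1r addr0 mulrBl mul1r => ->; rewrite addrAC subrr add0r.
  by apply: eq_bigr => l _; rewrite (pdy_pdy l r oD (lc_zeta L j) Dxy).
pose X r := \sum_l y 0 l * pdy l (Nc r i) x y - Nc r i x y.
have X0 j : \sum_r zetad zeta j r x y * X r = 0.
  have T l := zetad_transport i j l Dxy.
  have : \sum_l y 0 l * dop Nc i (zetad zeta j l) x y =
     h * pdx i (zc j) x y + (h - 1) * \sum_r Nc r i x y * zetad zeta j r x y.
    rewrite -E1 mulr_sumr.
    under [X in _ = _ + X]eq_bigr do rewrite mulrCA -E2 mulr_sumr.
    rewrite exchange_big/= -big_split; apply: eq_bigr => l _ /=.
    have S1 : pdx i (zetad zeta j l) x y = pdy l (pdx i (zc j)) x y.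
      exact: (esym (pdx_pdy i l oD (lc_zeta L j) Dxy)).
    have S2 r : pdy r (zetad zeta j l) x y = pdy l (zetad zeta j r) x y.
      exact: (pdy_pdy r l oD (lc_zeta L j) Dxy).
    rewrite /dop mulrDr S1 mulr_sumr.
    apply: (congr2 +%R); first by [].
    by apply: eq_bigr => r _; rewrite S2; exact: mulrCA.
  under eq_bigr do rewrite T mulrDr.
  rewrite big_split/=.
  have -> : \sum_l y 0 l * - conn a x i (frame zeta l x y) 0 j =
      - h * conn a x i (zeta x y) 0 j.
    rewrite mulNr -mulrN mxE.
    under eq_bigr do rewrite mulrN mxE mulr_sumr.
    rewrite sumrN exchange_big mulrN mulr_sumr; congr (- _).
    apply: eq_bigr => m _; rewrite mulrCA -zeta_euler// mulr_sumr.
    by apply: eq_bigr => l _; rewrite mxE mulrCA.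
  rewrite mulNr -mulrN -(zeta_transport L i j Dxy).
  have -> : \sum_l y 0 l * \sum_k Dco Nc k i l x y * zetad zeta j k x y =
     - \sum_r zetad zeta j r x y * \sum_l y 0 l * pdy l (Nc r i) x y.
    under eq_bigr do rewrite mulr_sumr.
    rewrite exchange_big -sumrN; apply: eq_bigr => r _ /=.
    rewrite -mulrN -sumrN mulr_sumr; apply: eq_bigr => l _.
    by rewrite /Dco; ring.
  under [X in _ -> X = _]eq_bigr do rewrite mulrBr.
  rewrite sumrB.
  have -> : \sum_r zetad zeta j r x y * Nc r i x y = \sum_r Nc r i x y * zetad zeta j r x y.
    by apply: eq_bigr => r _; rewrite mulrC.
  
  move: (\sum_r Nc _ _ _ _ * _) (\sum_r zetad _ _ _ _ _ * \sum_l _) (pdx i _ x y).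
  by move=> A B C; lra.
apply/eqP; rewrite -subr_eq0 -/(X k); apply/eqP.
transitivity (\sum_r (k == r)%:R * X r).
  rewrite (bigD1 k)//= eqxx mul1r big1 ?addr0// => l /negPf.
  by rewrite eq_sym => ->; rewrite mul0r.
under eq_bigr do rewrite -(frame_eta_zeta L _ _ Dxy) mulr_suml.
rewrite exchange_big big1// => j _.
by under eq_bigr do rewrite -mulrA; rewrite -mulr_sumr X0 mulr0.
Qed.

(** On unit vectors this is the hypothesis that [zeta] preserves them, and
    both sides are homogeneous of degree [2h]. *)
Lemma bil_zeta x y : D (x, y) ->
  bil (a x) (zeta x y) (zeta x y) = (K x y `^ h) ^+ 2.
Proof.
move=> Dxy; have K0 := lc_Kgt0 L Dxy.
have Ki : 0 < (K x y)^-1 by rewrite invr_gt0.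
have D1 := lc_Dcone L Ki Dxy.
have /(lc_unit L D1) : K x ((K x y)^-1 *: y) = 1.
  by rewrite (lc_Khom L Dxy Ki) mulVf// gt_eqF.
rewrite (lc_hom L Dxy Ki) /Snorm -/(bil _ _ _) bilZl bilZr.
set b := bil _ _ _ => S1.
have Kh0 : 0 < K x y `^ h by apply: powR_gt0.
have KK : (K x y)^-1 `^ h = (K x y `^ h)^-1.
  by apply: (mulfI (lt0r_neq0 Kh0)); rewrite -powRM ?ltW// !divff ?powR1 ?lt0r_neq0.
have /eqP : Num.sqrt ((K x y)^-1 `^ h * ((K x y)^-1 `^ h * b)) ^+ 2 = 1.
  by rewrite S1 expr1n.
rewrite sqr_sqrtr; last first.
  rewrite mulrA mulr_ge0 ?mulr_ge0 ?powR_ge0//.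
  exact: posdef_ge0 (lc_pos L (lc_DU L Dxy)).
rewrite KK => /eqP E1; have Kn := lt0r_neq0 Kh0.
by rewrite -[RHS]mulr1 -E1; field.
Qed.

(** Scalar products of vector fields that are parallel along [d_i] are
    constant along [d_i]. *)
Lemma is_derive_parallel_bil x y (v : vec) i (f g : vec -> vec -> vec) :
  D (x, y) ->
  is_derive (x, y) (base i, v) (fun q => f q.1 q.2) (- conn a x i (f x y)) ->
  is_derive (x, y) (base i, v) (fun q => g q.1 q.2) (- conn a x i (g x y)) ->
  is_derive (x, y) (base i, v) (fun q => bil (a q.1) (f q.1 q.2) (g q.1 q.2)) 0.
Proof.
move=> Dxy df dg; have Ux := lc_DU L Dxy.
have da := is_derive_fst y v (is_derive_metric oU (lc_a L) i Ux).
apply: (is_derive_eq (is_derive_bil da df dg)) => /=.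
rewrite (metricity oU (lc_sym L) (lc_pos L))// bilNl bilNr; ring.
Qed.

Definition Nrow i x y : vec := \row_k Nc k i x y.

Lemma is_derive_zeta i x y : D (x, y) ->
  is_derive (x, y) (base i, Nrow i x y) (fun q => zeta q.1 q.2)
    (- conn a x i (zeta x y)).
Proof.
move=> Dxy; apply/is_derive_mx => r j; rewrite ord1.
have := dop_derive Nc i (zeta_diff L j Dxy).
move/is_derive_eq; apply; rewrite [RHS]mxE.
by rewrite -(zeta_transport L i j Dxy).
Qed.

(** The derivative of [(K^h)^2] along [d_i] vanishes, and it is a positive
    multiple of [d_i K]. *)
Lemma dop_K i x y : D (x, y) -> dop Nc i K x y = 0.
Proof.
move=> Dxy; have K0 := lc_Kgt0 L Dxy; have h0 := lc_h L.
have dz := is_derive_zeta i Dxy.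
have D1 := is_derive_parallel_bil Dxy dz dz.
have P := is_derive1_powR h K0.
have D2 := is_derive_comp_real (is_derive_mul P P) (dop_derive Nc i (K_diff L Dxy)).
have := near_eq_is_derive _ D2 => /(_ (fun q => bil (a q.1) (zeta q.1 q.2) (zeta q.1 q.2))).
move=> /(_ _)/is_derive_uniq/(_ D1) H.
have /eqP : (h * K x y `^ (h - 1) * K x y `^ h + K x y `^ h * (h * K x y `^ (h - 1)))
    * dop Nc i K x y = 0.
  apply: H; have : \forall q \near (x, y), D q by exact: open_nbhs_nbhs.
  by apply: filterS => -[x' y'] D'; rewrite bil_zeta// expr2.
rewrite mulf_eq0 => /orP[|/eqP//]; rewrite gt_eqF//.
by rewrite addr_gt0 ?mulr_gt0 ?powR_gt0.
Qed.

Lemma cov_y i j x y : D (x, y) -> cov10 Nc i (fun k _ y' => y' 0 k) j x y = 0.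
Proof.
move=> Dxy; rewrite /cov10 /dop /pdx /pd derive_cst add0r.
under eq_bigr => k _.
  have -> : pdy k (fun _ y' : vec => y' 0 j) x y = (k == j)%:R.
    rewrite /pdy /pd; have /is_derive_mx/(_ 0 j) := is_derive_id y (base k).
    by move/@derive_val => /= ->; rewrite mxE eqxx eq_sym.
  over.
rewrite (bigD1 j)//= eqxx mulr1 [X in _ + X + _]big1 ?addr0; last first.
  by move=> k /negPf ->; rewrite mulr0.
rewrite -(Nc_euler j i Dxy) -big_split big1// => l _ /=.
by rewrite /Dco; ring.
Qed.

Lemma gtenE x y m n : D (x, y) -> gten K m n x y =
  (h^-1 * K x y `^ (1 - h)) ^+ 2 * bil (a x) (frame zeta m x y) (frame zeta n x y).
Proof.
move=> Dxy; rewrite (lc_metric L)//; congr (_ * _); apply: eq_bigr => i _.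
by apply: eq_bigr => j _; rewrite !mxE mulrC mulrA.
Qed.

Lemma metric_diff x m n : U x -> differentiable (fun x => a x m n) x.
Proof. exact: Ck_differentiable oU (lc_a L m n). Qed.

(** [g] is defined by second derivatives of [K^2]; the conformal relation
    exhibits it as a polynomial in differentiable functions. *)
Lemma gten_diff x y m n : D (x, y) -> differentiable (uncur (gten K m n)) (x, y).
Proof.
move=> Dxy; have K0 := lc_Kgt0 L Dxy; have Ux := lc_DU L Dxy.
have : \forall q \near (x, y), (h^-1 * uncur K q `^ (1 - h)) ^+ 2 *
    bil (a q.1) (frame zeta m q.1 q.2) (frame zeta n q.1 q.2) = uncur (gten K m n) q.
  have : \forall q \near (x, y), D q by exact: open_nbhs_nbhs.
  by apply: filterS => -[x' y'] D'; rewrite /uncur/= gtenE.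
move/near_eq_differentiable; apply.
have dz l j : differentiable (fun q : vec * vec => frame zeta l q.1 q.2 0 j) (x, y).
  under eq_fun do rewrite mxE.
  exact: (zetad_diff L j l Dxy).
apply: differentiableM; last first.
  apply: differentiable_bil => // k l.
  exact: (differentiable_fst_comp y (metric_diff k l Ux)).
have dk : differentiable (fun q => h^-1 * uncur K q `^ (1 - h)) (x, y).
  apply: differentiableM => //.
  exact: (differentiable_real (p := (x, y)) (g := uncur K)
    (is_derive1_powR (1 - h) K0) (K_diff L Dxy)).
by under eq_fun do rewrite expr2; exact: differentiableM.
Qed.

Lemma cov_g i j n x y : D (x, y) -> cov02 Nc i (gten K) j n x y = 0.
Proof.
move=> Dxy; have K0 := lc_Kgt0 L Dxy; have Ux := lc_DU L Dxy.
pose Dz m := \sum_k Dco Nc k i m x y *: frame zeta k x y.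
have dz m : is_derive (x, y) (base i, Nrow i x y) (fun q => frame zeta m q.1 q.2)
    (- conn a x i (frame zeta m x y) + Dz m).
  apply/is_derive_mx => r l; rewrite ord1.
  under eq_fun do rewrite mxE.
  apply: (is_derive_eq (dop_derive Nc i (zetad_diff L l m Dxy))).
  rewrite zetad_transport// [RHS]mxE [X in _ = X + _]mxE; congr (_ + _).
  by rewrite summxE; apply: eq_bigr => k _; rewrite !mxE.
pose ka (k : R) := (h^-1 * k `^ (1 - h)) * (h^-1 * k `^ (1 - h)).
have dka : is_derive (x, y) (base i, Nrow i x y) (fun q => ka (uncur K q)) 0.
  have P := is_derive_mul (is_derive_cst h^-1 (K x y) 1) (is_derive1_powR (1 - h) K0).
  have := is_derive_comp_real (is_derive_mul P P) (dop_derive Nc i (K_diff L Dxy)).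
  by move/is_derive_eq; apply; rewrite dop_K// mulr0.
have da := is_derive_fst y (Nrow i x y) (is_derive_metric oU (lc_a L) i Ux).
have dg := is_derive_mul dka (is_derive_bil da (dz j) (dz n)).
have gE : \forall q \near (x, y), ka (uncur K q) *
    bil (a q.1) (frame zeta j q.1 q.2) (frame zeta n q.1 q.2) = uncur (gten K j n) q.
  have : \forall q \near (x, y), D q by exact: open_nbhs_nbhs.
  by apply: filterS => -[x' y'] D'; rewrite /uncur/= gtenE.

have := is_derive_uniq (near_eq_is_derive gE dg) (dop_derive Nc i (gten_diff j n Dxy)).
rewrite mul0r add0r (metricity oU (lc_sym L) (lc_pos L))//=.
rewrite bilDl bilDr bilNl bilNr /Dz bil_suml bil_sumr.
have gK m k : gten K m k x y = ka (uncur K (x, y)) *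
    bil (a x) (frame zeta m x y) (frame zeta k x y) by rewrite gtenE.
rewrite /cov02 => <-.
have H1 : \sum_l Dco Nc l i j x y * gten K l n x y = ka (uncur K (x, y)) *
    \sum_l Dco Nc l i j x y * bil (a x) (frame zeta l x y) (frame zeta n x y).
  rewrite mulr_sumr; apply: eq_bigr => l _; rewrite gK; exact: mulrCA.
have H2 : \sum_l Dco Nc l i n x y * gten K j l x y = ka (uncur K (x, y)) *
    \sum_l Dco Nc l i n x y * bil (a x) (frame zeta j x y) (frame zeta l x y).
  rewrite mulr_sumr; apply: eq_bigr => l _; rewrite gK; exact: mulrCA.
have aux (k b1 b2 S1 S2 : R) :
  k * (b1 + b2 + (- b1 + S1) + (- b2 + S2)) - k * S1 - k * S2 = 0 by ring.
refine (etrans (congr2 (fun s t => _ - s - t) H1 H2) _).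
exact: aux.
Qed.

Lemma cov_ylow i j x y : D (x, y) -> cov01 Nc i (ylow K) j x y = 0.
Proof.
move=> Dxy.
have dy (k : 'I_N) : is_derive (x, y) (base i, Nrow i x y)
    (fun q : vec * vec => q.2 0 k) (Nc k i x y).
  have /is_derive_line/is_derive_mx/(_ 0 k) := is_derive_id y (Nrow i x y).
  by rewrite mxE => H; apply/is_derive_line.
have dg k := dop_derive Nc i (gten_diff j k Dxy).
have D1 := is_derive_bigsum (fun k => is_derive_mul (dg k) (dy k)).
have df : differentiable (uncur (ylow K j)) (x, y).
  apply: differentiable_bigsum => k; apply: differentiableM.
    exact: gten_diff.
  apply: (@differentiable_comp _ _ _ _ snd (fun v : vec => v 0 k)).
    by apply: (linear_differentiable (f := snd)); move=> q; exact: cvg_snd.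
  exact: differentiable_coord.
rewrite /cov01 (is_derive_uniq (dop_derive Nc i df) D1) /=.
have cg k := cov_g i j k Dxy.
have gE k : dop Nc i (gten K j k) x y =
    \sum_l Dco Nc l i j x y * gten K l k x y + \sum_l Dco Nc l i k x y * gten K j l x y.
  have /eqP := cg k; rewrite /cov02 -addrA -opprD subr_eq0 => /eqP ->.
  by [].
under eq_bigr do rewrite gE mulrDl.
rewrite !big_split /=.
have H1 : \sum_l Dco Nc l i j x y * ylow K l x y =
    \sum_k (\sum_l Dco Nc l i j x y * gten K l k x y) * y 0 k.
  under [RHS]eq_bigr do rewrite mulr_suml.
  rewrite exchange_big; apply: eq_bigr => l _ /=; rewrite mulr_sumr.
  by apply: eq_bigr => k _; rewrite mulrA.
have H2 : \sum_k (\sum_l Dco Nc l i k x y * gten K j l x y) * y 0 k =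
    - \sum_k gten K j k x y * Nc k i x y.
  transitivity (\sum_k \sum_l Dco Nc l i k x y * gten K j l x y * y 0 k).
    by apply: eq_bigr => k _; exact: mulr_suml.
  rewrite exchange_big -sumrN; apply: eq_bigr => l _ /=.
  transitivity (gten K j l x y * - \sum_k y 0 k * pdy k (Nc l i) x y).
    rewrite -sumrN mulr_sumr; apply: eq_bigr => k _.
    rewrite /Dco; move: (gten _ _ _ _ _) (pdy _ _ _ _) => g p; ring.
  by rewrite Nc_euler// mulrN.
have aux (s t : R) : s + - t + t - s = 0 by rewrite subrK subrr.
refine (etrans (congr2 (fun s t => _ + s + _ - t) H2 H1) _).
exact: aux.
Qed.

End Metricity.

(** * Great circles *)

Section GreatCircles.
Context {R : realType} {N : nat}.
Notation vec := ('rV[R]_N).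
Variable A : 'M[R]_N.
Hypothesis A_sym : A^T = A.
Hypothesis A_pos : posdef A.
Implicit Types (u v : vec) (t s : R).

Lemma near_unit_itv t : 0 < t < 1 -> \forall u \near t, 0 < u < 1.
Proof.
move=> t01; have tI : t \in `]0, 1[ by rewrite in_itv.
by have := near_in_itvoo tI; apply: filterS => u; rewrite in_itv.
Qed.

Lemma is_derive_trig (s t : R) :
  is_derive t (1 : R) (fun t => cos (s * t)) (- s * sin (s * t)) /\
  is_derive t (1 : R) (fun t => sin (s * t)) (s * cos (s * t)).
Proof.
have d : is_derive t (1 : R) (fun t => s * t) s.
  apply: (is_derive_eq (is_derive_mul (is_derive_cst s t (1 : R)) (is_derive_id t (1 : R)))).
  by rewrite mul0r add0r mulr1.
split.
  apply: (is_derive_eq (is_derive1_comp (is_derive_cos (s * t)) d)); ring.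
apply: (is_derive_eq (is_derive1_comp (is_derive_sin (s * t)) d)); ring.
Qed.

(** A curve on the unit sphere of the form [A] whose acceleration is normal to
    the sphere.  The curve is only assumed continuous at the ends of the
    interval. *)
Section Curve.
Variables w w1 w2 : R -> vec.
Hypothesis dw : forall t, 0 < t < 1 -> is_derive t (1 : R) w (w1 t).
Hypothesis dw1 : forall t, 0 < t < 1 -> is_derive t (1 : R) w1 (w2 t).
Hypothesis wcont : forall l, {within `[0, 1], continuous (fun t => w t 0 l)}.
Hypothesis wunit : forall t, 0 <= t <= 1 -> bil A (w t) (w t) = 1.
Hypothesis wgeo : forall t, 0 < t < 1 -> forall u,
  bil A (w t) u = 0 -> bil A (w2 t) u = 0.

Let dA t : is_derive t (1 : R) (fun _ : R => A) 0.
Proof. exact: is_derive_cst. Qed.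

(** Derivative of [A(w, w) = 1]. *)
Lemma velocity_orthogonal t : 0 < t < 1 -> bil A (w t) (w1 t) = 0.
Proof.
move=> t01; have d1 := is_derive_bil (dA t) (dw t01) (dw t01).
have d2 : is_derive t (1 : R) (fun t => bil A (w t) (w t)) 0.
  apply: near_eq_is_derive (is_derive_cst (1 : R) t (1 : R)).
  apply: filterS (near_unit_itv t01) => u /andP[u0 u1].
  by rewrite wunit// !ltW.
have := is_derive_uniq d1 d2; rewrite [bil 0 _ _]bilE mulmx0 mul0mx mxE add0r.
rewrite (bilC (w1 t)) // => E; lra.
Qed.

(** The acceleration is normal, hence a multiple of [w]; the factor comes from
    differentiating [A(w, w') = 0]. *)
Lemma acceleration t : 0 < t < 1 -> w2 t = - bil A (w1 t) (w1 t) *: w t.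
Proof.
move=> t01; have d1 := is_derive_bil (dA t) (dw t01) (dw1 t01).
have d2 : is_derive t (1 : R) (fun t => bil A (w t) (w1 t)) 0.
  apply: near_eq_is_derive (is_derive_cst (0 : R) t (1 : R)).
  by apply: filterS (near_unit_itv t01) => u u01; rewrite velocity_orthogonal.
have := is_derive_uniq d1 d2; rewrite [bil 0 _ _]bilE mulmx0 mul0mx mxE add0r.
move=> E; have {E} -> : - bil A (w1 t) (w1 t) = bil A (w t) (w2 t) by lra.
have ww : bil A (w t) (w t) = 1 by case/andP: t01 => *; rewrite wunit// !ltW.
apply/eqP; rewrite -subr_eq0; apply/eqP; set l := bil _ _ _.
have E1 : bil A (w t) (w2 t - l *: w t) = 0.
  by rewrite bilBr bilZr ww mulr1 subrr.
by apply: (posdef_eq0 A_pos); rewrite bilBl bilZl E1 (wgeo t01 E1); ring.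
Qed.

Lemma constant_speed : exists2 s, 0 <= s &
  forall t, 0 < t < 1 -> bil A (w1 t) (w1 t) = s ^+ 2.
Proof.
have h01 : 0 < (2^-1 : R) < 1 by lra.
exists (Num.sqrt (bil A (w1 2^-1) (w1 2^-1))); first exact: sqrtr_ge0.
move=> t t01; rewrite sqr_sqrtr ?posdef_ge0//.
apply: (@derive0_cst_oo _ (fun t => bil A (w1 t) (w1 t)) 0 1) => // u u01.
apply: (is_derive_eq (is_derive_bil (dA u) (dw1 u01) (dw1 u01))).
rewrite [bil 0 _ _]bilE mulmx0 mul0mx mxE add0r acceleration//.
by rewrite bilZl bilZr (bilC (w1 u)) // velocity_orthogonal// mulr0 addr0.
Qed.

Lemma coord_ends (g : R -> vec) : (forall l, continuous (fun t => g t 0 l)) ->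
  (forall t, 0 < t < 1 -> w t = g t) -> forall t, 0 <= t <= 1 -> w t = g t.
Proof.
move=> cg wg t t01; apply/rowP => l.
have [e0 e1] : w 0 0 l - g 0 0 l = 0 /\ w 1 0 l - g 1 0 l = 0.
  apply: (@within_eq_ends R (fun t => w t 0 l - g t 0 l) 0 0 1 ltr01).
    move=> u; apply: continuousB; first exact: wcont.
    by apply: continuous_subspaceT => v; exact: cg.
  by move=> u u01; rewrite wg// subrr.
case/andP: t01; rewrite le_eqVlt => /predU1P[<- _|t0].
  by apply/eqP; rewrite -subr_eq0 e0.
rewrite le_eqVlt => /predU1P[->|t1]; first by apply/eqP; rewrite -subr_eq0 e1.
by rewrite wg// t0.
Qed.

(** With constant speed [s] the equation is [w'' = - s^2 w], for which [P] and
    [Q] below are first integrals; for [s = 0] the curve is constant and the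
    vector [B] is arbitrary. *)
Lemma great_circle : exists s (B : vec), [/\ 0 <= s,
  forall t, 0 < t < 1 -> bil A (w1 t) (w1 t) = s ^+ 2,
  forall t, 0 <= t <= 1 -> w t = cos (s * t) *: w 0 + sin (s * t) *: B &
  s = 0 \/ bil A (w 0) B = 0 /\ bil A B B = 1].
Proof.
have [s s0 speed] := constant_speed.
have h01 : 0 < (2^-1 : R) < 1 by lra.
have [s00|sn0] := eqVneq s 0.
  exists s, 0; split=> //; last by left.
  have wc t : 0 < t < 1 -> w t = w 2^-1.
    move=> t01; apply/rowP => l.
    apply: (@derive0_cst_oo _ (fun t => w t 0 l) 0 1) => // u u01.
    have /is_derive_mx/(_ 0 l) := dw u01.
    rewrite (_ : w1 u = 0) ?mxE//; apply: (posdef_eq0 A_pos).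
    by rewrite speed// s00 expr0n.
  have wE : forall t, 0 <= t <= 1 -> w t = w 2^-1.
    by apply: (@coord_ends (fun=> w 2^-1)) => // l; exact: cst_continuous.
  move=> t t01; rewrite s00 mul0r cos0 scale1r scaler0 addr0.
  by rewrite wE// (wE 0)// lexx ler01.
have w2E t : 0 < t < 1 -> w2 t = - s ^+ 2 *: w t.
  by move=> t01; rewrite acceleration// speed.
pose P t : vec := s * cos (s * t) *: w t - sin (s * t) *: w1 t.
pose Q t : vec := s * sin (s * t) *: w t + cos (s * t) *: w1 t.
have dP t l : 0 < t < 1 -> is_derive t (1 : R) (fun t => P t 0 l) 0.
  move=> t01; have [dc ds] := is_derive_trig s t.
  have /is_derive_mx/(_ 0 l) d0 := dw t01; have /is_derive_mx/(_ 0 l) d1 := dw1 t01.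
  have -> : (fun t => P t 0 l) =
     (fun t => s * cos (s * t) * w t 0 l - sin (s * t) * w1 t 0 l).
    by apply/funext => u; rewrite !mxE.
  apply: (is_derive_eq (is_deriveB (is_derive_mul (is_derive_mul
     (is_derive_cst s t (1 : R)) dc) d0) (is_derive_mul ds d1))).
  by rewrite w2E// !mxE /cst; ring.
have dQ t l : 0 < t < 1 -> is_derive t (1 : R) (fun t => Q t 0 l) 0.
  move=> t01; have [dc ds] := is_derive_trig s t.
  have /is_derive_mx/(_ 0 l) d0 := dw t01; have /is_derive_mx/(_ 0 l) d1 := dw1 t01.
  have -> : (fun t => Q t 0 l) =
     (fun t => s * sin (s * t) * w t 0 l + cos (s * t) * w1 t 0 l).
    by apply/funext => u; rewrite !mxE.
  apply: (is_derive_eq (is_deriveD (is_derive_mul (is_derive_mul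
     (is_derive_cst s t (1 : R)) ds) d0) (is_derive_mul dc d1))).
  by rewrite w2E// !mxE /cst; ring.
pose p : vec := s^-1 *: P 2^-1; pose q : vec := s^-1 *: Q 2^-1.
have PE t : 0 < t < 1 -> s^-1 *: P t = p.
  move=> t01; congr (_ *: _); apply/rowP => l.
  by apply: (@derive0_cst_oo _ (fun t => P t 0 l) 0 1) => // u; exact: dP.
have QE t : 0 < t < 1 -> s^-1 *: Q t = q.
  move=> t01; congr (_ *: _); apply/rowP => l.
  by apply: (@derive0_cst_oo _ (fun t => Q t 0 l) 0 1) => // u; exact: dQ.
have wE : forall t, 0 <= t <= 1 -> w t = cos (s * t) *: p + sin (s * t) *: q.
  apply: coord_ends => [l t|t t01].
    have [dc ds] := is_derive_trig s t.
    have [d _] := is_deriveD (is_derive_mul dc (is_derive_cst (p 0 l) t (1 : R)))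
      (is_derive_mul ds (is_derive_cst (q 0 l) t (1 : R))).
    rewrite (_ : (fun t : R => _) =
      (fun t => cos (s * t) * p 0 l) + (fun t => sin (s * t) * q 0 l)).
      exact: differentiable_continuous ((derivable1_diffP _ _).1 d).
    by apply/funext => u; rewrite !mxE.
  rewrite -(PE _ t01) -(QE _ t01) /P /Q; apply/rowP => l; rewrite !mxE.
  have E := cos2Dsin2 (s * t).
  rewrite -[LHS]mul1r -E; field.
  exact: sn0.
have p0 : w 0 = p.
  by rewrite wE ?lexx ?ler01// mulr0 cos0 sin0 scale1r scale0r addr0.
exists s, q; rewrite p0; split=> //; right.
have o := velocity_orthogonal h01; have sp := speed _ h01.
have un : bil A (w 2^-1) (w 2^-1) = 1 by rewrite wunit//; lra.
have E := cos2Dsin2 (s * 2^-1).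
rewrite /p /q /P /Q; move: o sp un E.
set c := cos _; set d := sin _; set u := w _; set v := w1 _ => o sp un E.
rewrite !(bilZl, bilZr, bilDl, bilDr, bilNl, bilNr) (bilC v u)// o sp un.
split; first by field.
by transitivity (c ^+ 2 + d ^+ 2); [field|].
Qed.

End Curve.

(** The chord only sees [s] modulo full turns, which is why the length of an
    arbitrary geodesic arc is bounded below by [asin_sin_le]. *)
Lemma sqchord_great_circle (s : R) (a b : vec) :
  bil A a a = 1 -> s = 0 \/ bil A a b = 0 /\ bil A b b = 1 ->
  let c := cos s *: a + sin s *: b in
  bil A (a - c) (a - c) = 4 * sin (s / 2) ^+ 2.
Proof.
move=> aa H c; have cs : cos s = 1 - 2 * sin (s / 2) ^+ 2.
  rewrite {1}(_ : s = s / 2 *+ 2); last by rewrite mulr2n -splitr.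
  by rewrite cos_mulr2n; have := cos2Dsin2 (s / 2); lra.
case: H => [s0|[ab bb]].
  by rewrite /c s0 cos0 sin0 mul0r sin0 scale1r scale0r addr0 subrr bil0l; ring.
have E := cos2Dsin2 s.
rewrite /c !(bilDl, bilDr, bilNl, bilNr, bilZl, bilZr) (bilC b a)// ab aa bb.
lra.
Qed.

Lemma asin_sin_le (u : R) : 0 <= u -> asin `|sin u| <= u.
Proof.
move=> u0; have s1 : `|sin u| <= 1 by rewrite ler_norml sin_geN1 sin_le1.
have s0 : -1 <= `|sin u| by rewrite (le_trans _ (normr_ge0 _))// lerN10.
have [uh|uh] := leP u (pi / 2); last first.
  by rewrite (le_trans _ (ltW uh))// asin_lepi2// s0.
rewrite ger0_norm; last by rewrite sin_ge0_pi// u0 (le_trans uh)// ler_piMr// ?pi_ge0// invf_le1// ler1n.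
by rewrite sinK// in_itv/= uh andbT (le_trans _ u0)// oppr_le0 divr_ge0// pi_ge0.
Qed.

End GreatCircles.

(** * Geodesics of the indicatrix *)

Lemma sum2_scale {R : realType} {N : nat} (k : R) (f : 'I_N -> 'I_N -> R) :
  k * (\sum_i \sum_j f i j) = \sum_i \sum_j k * f i j.
Proof. by rewrite mulr_sumr; apply: eq_bigr => i _; rewrite mulr_sumr. Qed.

Lemma sum2_lin {R : realType} {N : nat} (f g p q : 'I_N -> 'I_N -> R) :
  \sum_i \sum_j (f i j + g i j - p i j + q i j) =
  \sum_i \sum_j f i j + \sum_i \sum_j g i j - \sum_i \sum_j p i j
  + \sum_i \sum_j q i j.
Proof.
rewrite -sumrN -!big_split; apply: eq_bigr => i _ /=.
by rewrite -sumrN -!big_split.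
Qed.

Section Indicatrix.
Context {R : realType} {N : nat}.
Notation vec := ('rV[R]_N).
Variables (U : set vec) (K : vec -> vec -> R) (a : vec -> 'M[R]_N)
  (D E : set (vec * vec)) (zeta eta : vec -> vec -> vec) (h : R).
Hypothesis L : local_conformal U K a D E zeta eta h.
Implicit Types (x y z u v w : vec) (i j k l m n : 'I_N).

Let oD := lc_openD L.

(** The differential of [zeta x] at [y] applied to [v]. *)
Definition push x y v : vec := \sum_k v 0 k *: frame zeta k x y.

Definition dframe l k x y : vec := \row_j pdy l (zetad zeta j k) x y.

Lemma dframe_sym l k x y : D (x, y) -> dframe l k x y = dframe k l x y.
Proof.
move=> Dxy; apply/rowP => j; rewrite [LHS]mxE [RHS]mxE.
exact: (pdy_pdy l k oD (lc_zeta L j) Dxy).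
Qed.

Lemma push_surj x y u : D (x, y) -> exists v, push x y v = u.
Proof.
move=> Dxy; exists (\row_k \sum_l yinvd zeta eta k l x y * u 0 l).
apply/rowP => j; rewrite summxE.
transitivity (\sum_l (\sum_k zetad zeta j k x y * yinvd zeta eta k l x y) * u 0 l).
  under [RHS]eq_bigr do rewrite mulr_suml.
  rewrite exchange_big; apply: eq_bigr => k _ /=; rewrite !mxE mulr_suml.
  by apply: eq_bigr => l _; ring.
rewrite (bigD1 j)//= (frame_zeta_eta L)// eqxx mul1r big1 ?addr0// => l lj.
by rewrite (frame_zeta_eta L)// eq_sym (negPf lj) mul0r.
Qed.

Lemma is_derive_zeta_fiber k x y : D (x, y) ->
  is_derive y (base k) (zeta x) (frame zeta k x y).
Proof.
move=> Dxy; apply/is_derive_mx => r j; rewrite ord1 mxE.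
exact: (Cxy_derive_fiber k (lc_zeta L j)).
Qed.

Lemma is_derive_frame l k x y : D (x, y) ->
  is_derive y (base l) (frame zeta k x) (dframe l k x y).
Proof.
move=> Dxy; apply/is_derive_mx => r j; rewrite ord1 mxE.
under eq_fun do rewrite mxE.
exact: (Cxy_derive_fiber l (Cxy_pdy k (lc_zeta L j))).
Qed.

Lemma is_derive_pdyK k x y : D (x, y) -> is_derive y (base k) (K x) (pdy k K x y).
Proof. exact: Cxy_derive_fiber (lc_K L). Qed.

Lemma dK_frame k x y : D (x, y) -> K x y = 1 ->
  bil (a x) (zeta x y) (frame zeta k x y) = h * pdy k K x y.
Proof.
move=> Dxy K1; have Ux := lc_DU L Dxy.
have dz := is_derive_zeta_fiber k Dxy.
have d1 := is_derive_bil (is_derive_cst (a x) y (base k)) dz dz.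
have K0 := lc_Kgt0 L Dxy.
have P := is_derive1_powR h K0.
have d2 := is_derive_comp_real (is_derive_mul P P) (is_derive_pdyK k Dxy).
have ne : \forall y' \near y, K x y' `^ h * K x y' `^ h =
    bil (a x) (zeta x y') (zeta x y').
  by apply: filterS (near_fiber oD Dxy) => y' D'; rewrite (bil_zeta L)// expr2.
have := is_derive_uniq d1 (near_eq_is_derive ne d2).
rewrite [bil 0 _ _]bilE mulmx0 mul0mx mxE add0r K1 !powR1.
rewrite /cst (bilC (frame _ _ _ _)) ?(lc_sym L)// => e.
have -> : bil (a x) (zeta x y) (frame zeta k x y) =
  (bil (a x) (zeta x y) (frame zeta k x y) + bil (a x) (zeta x y) (frame zeta k x y)) / 2.
  by field.
by rewrite e; field.
Qed.

(** Derivative of [a(zeta, zeta) = K^(2h)] along the fibre: vectors tangent to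
    the indicatrix correspond to vectors tangent to the unit sphere. *)
Lemma dK_push x y v : D (x, y) -> K x y = 1 ->
  bil (a x) (zeta x y) (push x y v) = h * \sum_k pdy k K x y * v 0 k.
Proof.
move=> Dxy K1; rewrite /push bil_sumr mulr_sumr; apply: eq_bigr => k _.
by rewrite dK_frame// mulrC mulrA.
Qed.

Lemma gten_push x y v : D (x, y) -> K x y = 1 ->
  \sum_m \sum_n gten K m n x y * v 0 m * v 0 n =
  h^-1 ^+ 2 * bil (a x) (push x y v) (push x y v).
Proof.
move=> Dxy K1; rewrite {1}/push bil_suml mulr_sumr; apply: eq_bigr => m _.
rewrite /push bil_sumr !mulr_sumr; apply: eq_bigr => n _.
have -> := gtenE L m n Dxy; rewrite K1 powR1 mulr1.
by move: (bil _ _ _) => b; ring.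
Qed.

Lemma pdy_gten i j k x y : D (x, y) -> K x y = 1 ->
  pdy i (gten K j k) x y =
  2 * h^-1 ^+ 2 * (1 - h) * pdy i K x y * bil (a x) (frame zeta j x y) (frame zeta k x y)
  + h^-1 ^+ 2 * (bil (a x) (dframe i j x y) (frame zeta k x y)
                 + bil (a x) (frame zeta j x y) (dframe i k x y)).
Proof.
move=> Dxy K1; have K0 := lc_Kgt0 L Dxy.
have P := is_derive_mul (is_derive_cst h^-1 (K x y) 1) (is_derive1_powR (1 - h) K0).
have d1 := is_derive_comp_real (is_derive_mul P P) (is_derive_pdyK i Dxy).
have d2 := is_derive_mul d1 (is_derive_bil (is_derive_cst (a x) y (base i))
  (is_derive_frame i j Dxy) (is_derive_frame i k Dxy)).
have ne : \forall y' \near y, h^-1 * K x y' `^ (1 - h) * (h^-1 * K x y' `^ (1 - h))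
   * bil (a x) (frame zeta j x y') (frame zeta k x y') = gten K j k x y'.
  apply: filterS (near_fiber oD Dxy) => y' D'.
  by rewrite (gtenE L j k D') expr2.
have [_ e] := near_eq_is_derive ne d2.
have -> : pdy i (gten K j k) x y = _ := e.
rewrite /cst K1 !powR1 [bil 0 _ _]bilE mulmx0 mul0mx mxE.
move: (bil _ _ _) (bil _ _ _) (bil _ _ _) (pdy _ _ _ _) => b1 b2 b3 p; ring.
Qed.

(** The first summand comes from the derivative of the conformal factor.  The
    second is the Christoffel symbol of the flat metric pulled back by [zeta],
    because the second derivatives of [zeta] are symmetric. *)
Lemma gchrE i j k x y : D (x, y) -> K x y = 1 ->
  gchr K i j k x y =
  h^-1 ^+ 2 * (1 - h) *
   (pdy i K x y * bil (a x) (frame zeta j x y) (frame zeta k x y)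
    + pdy j K x y * bil (a x) (frame zeta i x y) (frame zeta k x y)
    - pdy k K x y * bil (a x) (frame zeta i x y) (frame zeta j x y))
  + h^-1 ^+ 2 * bil (a x) (dframe i j x y) (frame zeta k x y).
Proof.
move=> Dxy K1; rewrite /gchr !pdy_gten//.
have As := lc_sym L (lc_DU L Dxy).
have e1 : bil (a x) (dframe j i x y) (frame zeta k x y) =
          bil (a x) (dframe i j x y) (frame zeta k x y).
  exact: (congr1 (bil (a x) ^~ (frame zeta k x y)) (dframe_sym j i Dxy)).
have e2 : bil (a x) (dframe k i x y) (frame zeta j x y) =
          bil (a x) (frame zeta j x y) (dframe i k x y).
  rewrite (bilC _ _ As).
  exact: (congr1 (bil (a x) (frame zeta j x y)) (dframe_sym k i Dxy)).
have e3 : bil (a x) (frame zeta i x y) (dframe k j x y) =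
          bil (a x) (frame zeta i x y) (dframe j k x y).
  exact: (congr1 (bil (a x) (frame zeta i x y)) (dframe_sym k j Dxy)).
have aux (c d p1 p2 p3 G1 G2 G3 b1 b1' b2 b2' b3 b3' : R) :
  b1' = b1 -> b2' = b2 -> b3' = b3 ->
  (2 * c * d * p1 * G1 + c * (b1 + b2) + (2 * c * d * p2 * G2 + c * (b1' + b3))
   - (2 * c * d * p3 * G3 + c * (b2' + b3'))) / 2 =
  c * d * (p1 * G1 + p2 * G2 - p3 * G3) + c * b1.
  by move=> -> -> ->; field.
exact: aux e1 e2 e3.
Qed.

(** Every term that involves the derivative of the conformal factor contains
    [dK(c1)] or [dK(v)], so what remains is the scalar product of the
    acceleration of the image curve with the image of [v]. *)
Lemma geodesic_expr x y (c1 c2 v : vec) : D (x, y) -> K x y = 1 ->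
  \sum_k pdy k K x y * c1 0 k = 0 -> \sum_k pdy k K x y * v 0 k = 0 ->
  \sum_k (\sum_l gten K l k x y * c2 0 l
           + \sum_i \sum_j gchr K i j k x y * c1 0 i * c1 0 j) * v 0 k =
  h^-1 ^+ 2 * bil (a x) (push x y c2 + \sum_i c1 0 i *: \sum_j c1 0 j *: dframe i j x y)
                  (push x y v).
Proof.
move=> Dxy K1 c1t vt.
pose G j k := bil (a x) (frame zeta j x y) (frame zeta k x y).
pose W := \sum_i c1 0 i *: \sum_j c1 0 j *: dframe i j x y.
pose X := h^-1 ^+ 2 * (1 - h).
have g1 k : \sum_l gten K l k x y * c2 0 l =
    h^-1 ^+ 2 * bil (a x) (push x y c2) (frame zeta k x y).
  rewrite /push bil_suml mulr_sumr; apply: eq_bigr => l _.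
  have -> := gtenE L l k Dxy; rewrite K1 powR1 mulr1.
  by move: (bil _ _ _) => b; ring.
have g2 k : \sum_i \sum_j gchr K i j k x y * c1 0 i * c1 0 j =
    - X * (\sum_i \sum_j G i j * c1 0 i * c1 0 j) * pdy k K x y
    + h^-1 ^+ 2 * bil (a x) W (frame zeta k x y).
  transitivity (X * (\sum_i \sum_j (pdy i K x y * c1 0 i) * (G j k * c1 0 j))
    + X * (\sum_i \sum_j (pdy j K x y * c1 0 j) * (G i k * c1 0 i))
    - X * pdy k K x y * (\sum_i \sum_j G i j * c1 0 i * c1 0 j)
    + h^-1 ^+ 2 * bil (a x) W (frame zeta k x y)).
    rewrite [bil _ W _](_ : _ =
      \sum_i \sum_j c1 0 i * (c1 0 j * bil (a x) (dframe i j x y) (frame zeta k x y))).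
      rewrite !sum2_scale -sum2_lin.
      apply: eq_bigr => i _; apply: eq_bigr => j _.
      rewrite gchrE// -/(G i j) -/(G j k) -/(G i k) /X.
      move: (G _ _) (G _ _) (G _ _) (pdy _ _ _ _) (pdy _ _ _ _) (pdy _ _ _ _) (bil _ _ _).
      by move=> *; ring.
    rewrite /W bil_suml; apply: eq_bigr => i _.
    by rewrite bil_suml mulr_sumr.
  have -> : \sum_i \sum_j (pdy i K x y * c1 0 i) * (G j k * c1 0 j) = 0.
    by rewrite exchange_big big1// => j _; rewrite -mulr_suml c1t mul0r.
  have -> : \sum_i \sum_j (pdy j K x y * c1 0 j) * (G i k * c1 0 i) = 0.
    by rewrite big1// => i _; rewrite -mulr_suml c1t mul0r.
  rewrite !mulr0 addr0 add0r; congr (_ + _).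
  by move: (\sum_i _) (pdy _ _ _ _) => s p; ring.
transitivity (\sum_k (h^-1 ^+ 2 * (v 0 k * bil (a x) (push x y c2 + W) (frame zeta k x y))
   + - X * (\sum_i \sum_j G i j * c1 0 i * c1 0 j) * (pdy k K x y * v 0 k))).
  apply: eq_bigr => k _; rewrite g1 g2 bilDl.
  move: (\sum_i _) (pdy _ _ _ _) (bil _ _ _) (bil _ _ _) => s p b1 b2; ring.
rewrite big_split /= -!mulr_sumr vt mulr0 addr0; congr (_ * _).
by rewrite {2}/push bil_sumr.
Qed.

End Indicatrix.

(** The velocity of an arc at the ends of [[0, 1]] is not controlled. *)
Lemma Rintegral_const_oo {R : realType} (f : R -> R) (l : R) :
  (forall t, 0 < t < 1 -> f t = l) ->
  \int[lebesgue_measure]_(t in `[0, 1]) f t = l.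
Proof.
move=> fl; rewrite /Rintegral.
rewrite (@integral_itv_bndoo _ 0 1 (EFin \o f) true false); last first.
  move=> mD Y mY; have [lY|nlY] := pselect (Y l%:E).
    rewrite (_ : _ `&` _ = `]0, 1[%classic)//.
    apply/seteqP; split=> [t []//|t t01]; split=> //=.
    by rewrite fl//; rewrite /= in_itv in t01.
  rewrite (_ : _ `&` _ = set0); first exact: measurable0.
  rewrite -subset0 => t [/=]; rewrite in_itv/= => /fl ->.
  exact: nlY.
transitivity (fine (\int[lebesgue_measure]_(t in `](0 : R), (1 : R)[%classic) (cst l%:E) t)).
  by congr fine; apply: eq_integral => t; rewrite inE/= in_itv/= => /fl ->.
by rewrite integral_cst//= lebesgue_measure_itv/= lte_fin ltr01 oppr0 adde0 mule1.
Qed.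

Section Geodesics.
Context {R : realType} {N : nat}.
Notation vec := ('rV[R]_N).
Variables (U : set vec) (K : vec -> vec -> R) (a : vec -> 'M[R]_N)
  (D E : set (vec * vec)) (zeta eta : vec -> vec -> vec) (h : R).
Hypothesis L : local_conformal U K a D E zeta eta h.
Implicit Types (x y z u v : vec) (i j k l m n : 'I_N) (c : R -> vec) (t s : R).

Let oE := lc_openE L.

Lemma is_derive_curve f x c t d : is_derive t (1 : R) c d ->
  differentiable (uncur f) (x, c t) ->
  is_derive t (1 : R) (fun t => f x (c t)) (\sum_k d 0 k * pdy k f x (c t)).
Proof.
move=> dc df; apply: (is_derive_eq (is_derive_bundle (is_derive_cst x t (1 : R)) dc df)).
by rewrite big1 ?add0r// => k _; rewrite mxE mul0r.
Qed.

Lemma is_derive_image x c t d : D (x, c t) -> is_derive t (1 : R) c d ->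
  is_derive t (1 : R) (fun t => zeta x (c t)) (push zeta x (c t) d).
Proof.
move=> Dc dc; apply/is_derive_mx => r j; rewrite ord1.
apply: (is_derive_eq (is_derive_curve dc (zeta_diff L j Dc))).
by rewrite summxE; apply: eq_bigr => k _; rewrite !mxE.
Qed.

(** The value is the acceleration of the image curve, in the shape in which it
    occurs in [geodesic_expr]. *)
Lemma is_derive_velocity x c (c1 : R -> vec) t d2 : D (x, c t) ->
  is_derive t (1 : R) c (c1 t) -> is_derive t (1 : R) c1 d2 ->
  is_derive t (1 : R) (fun t => push zeta x (c t) (c1 t))
    (push zeta x (c t) d2
     + \sum_i c1 t 0 i *: \sum_j c1 t 0 j *: dframe zeta i j x (c t)).
Proof.
move=> Dc dc /is_derive_mx dc1; apply/is_derive_mx => r p; rewrite ord1.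
rewrite (_ : (fun t => _) =
   fun t => \sum_k c1 t 0 k * zetad zeta p k x (c t)); last first.
  by apply/funext => u; rewrite summxE; apply: eq_bigr => k _; rewrite !mxE.
apply: (is_derive_eq (is_derive_bigsum (fun k =>
  is_derive_mul (dc1 0 k) (is_derive_curve dc (zetad_diff L p k Dc))))).
rewrite big_split mxE !summxE /=; congr (_ + _).
  by apply: eq_bigr => k _; rewrite !mxE.
under eq_bigr do rewrite mulr_sumr.
rewrite exchange_big /=; apply: eq_bigr => i _.
rewrite mxE summxE mulr_sumr; apply: eq_bigr => j _.
rewrite mxE [X in _ * (_ * X)]mxE; exact: mulrCA.
Qed.

Lemma arc_length_unit x c s : 0 <= s ->
  (forall t, 0 < t < 1 -> D (x, c t) /\ K x (c t) = 1) ->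
  (forall t, 0 < t < 1 ->
    bil (a x) (push zeta x (c t) (derive1 c t)) (push zeta x (c t) (derive1 c t))
    = s ^+ 2) ->
  arc_length K x c = s / h.
Proof.
move=> s0 Dc sp; apply: Rintegral_const_oo => t t01; have [Dt Kt] := Dc t t01.
rewrite (gten_push L)// sp// -exprMn sqrtr_sqr mulrC ger0_norm//.
by rewrite divr_ge0// ltW// (lc_h L).
Qed.

Lemma dK_curve x c t d : (forall t, 0 < t < 1 -> D (x, c t) /\ K x (c t) = 1) ->
  0 < t < 1 -> is_derive t (1 : R) c d -> \sum_k pdy k K x (c t) * d 0 k = 0.
Proof.
move=> Dc t01 dc; have [Dt _] := Dc t t01.
have d1 := is_derive_curve dc (K_diff L Dt).
have d2 : is_derive t (1 : R) (fun t => K x (c t)) 0.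
  apply: near_eq_is_derive (is_derive_cst (1 : R) t (1 : R)).
  by apply: filterS (near_unit_itv t01) => u /Dc[_ ->].
apply: etrans (is_derive_uniq d1 d2).
by apply: eq_bigr => k _; exact: mulrC.
Qed.

Lemma zeta_cont j x y : D (x, y) -> {for y, continuous (fun y => zeta x y 0 j)}.
Proof.
move=> Dxy; apply: differentiable_continuous.
have dp : differentiable (fun y' : vec => (x, y')) y by exact: differentiable_pair.
exact: (differentiable_comp dp (zeta_diff L j Dxy)).
Qed.

Lemma unit_image x y : D (x, y) -> K x y = 1 -> bil (a x) (zeta x y) (zeta x y) = 1.
Proof. by move=> Dxy K1; rewrite (bil_zeta L)// K1 powR1 expr1n. Qed.

(** The geodesic equation tests against all [v] with [dK(v) = 0]; since
    [push] is onto, the acceleration of the image curve is normal to the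
    sphere. *)
Lemma geodesic_great_circle x p q c : geodesic_arc D K x p q c ->
  exists s B, [/\ 0 <= s, arc_length K x c = s / h,
    forall t, 0 <= t <= 1 ->
      E (x, cos (s * t) *: zeta x p + sin (s * t) *: B),
    zeta x q = cos s *: zeta x p + sin s *: B &
    s = 0 \/ bil (a x) (zeta x p) B = 0 /\ bil (a x) B B = 1].
Proof.
move=> [[c0 c1] cc Dc dc geo].
have Dc' t : 0 < t < 1 -> D (x, c t) /\ K x (c t) = 1.
  by move=> /andP[t0 t1]; apply: Dc; rewrite !ltW.
have Ux : U x.
  have [|D0 _] := Dc 0; first by rewrite lexx ler01.
  exact: (lc_DU L D0).
have d1 t : 0 < t < 1 -> is_derive t (1 : R) c (derive1 c t).
  by move=> /dc[dct _]; rewrite derive1E; exact/derivableP.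
have d2 t : 0 < t < 1 -> is_derive t (1 : R) (derive1 c) (derive1 (derive1 c) t).
  by move=> /dc[_ dct]; rewrite (derive1E (derive1 c)); exact/derivableP.
pose w t := zeta x (c t).
pose w1 t := push zeta x (c t) (derive1 c t).
pose w2 t := push zeta x (c t) (derive1 (derive1 c) t)
  + \sum_i derive1 c t 0 i *: \sum_j derive1 c t 0 j *: dframe zeta i j x (c t).
have [||||| s [B [s0 sp wE H]]] :=
  @great_circle R N (a x) (lc_sym L Ux) (lc_pos L Ux) w w1 w2.
- by move=> t t01; have [Dt _] := Dc' t t01; apply: is_derive_image (d1 t t01).
- move=> t t01; have [Dt _] := Dc' t t01.
  exact: is_derive_velocity (d1 t t01) (d2 t t01).
- move=> l; apply/subspace_continuousP => t t01.
  apply: (@cvg_comp _ _ _ c (fun y => zeta x y 0 l)).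
    by move/subspace_continuousP: cc; apply.
  by apply: zeta_cont; have [] := Dc t; rewrite ?(itvP t01).
- by move=> t t01; have [Dt Kt] := Dc t t01; exact: unit_image.
- move=> t t01 u; have [Dt Kt] := Dc' t t01.
  have [v <-] := push_surj L u Dt; rewrite (dK_push L)// => /eqP.
  rewrite mulf_eq0 (gt_eqF (lc_h L))/= => /eqP vt.
  have := geo t t01 v vt.
  rewrite (geodesic_expr L (derive1 (derive1 c) t) Dt Kt (dK_curve Dc' t01 (d1 t t01)) vt) => /eqP.
  by rewrite mulf_eq0 expf_eq0/= invr_eq0 (gt_eqF (lc_h L))/= => /eqP.
have w0 : w 0 = zeta x p by rewrite /w c0.
exists s, B; split=> //.
- by apply: arc_length_unit.
- move=> t t01; rewrite -w0 -wE//; have [Dt _] := Dc t t01.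
  by have [] := lc_to L Dt.
- by rewrite -c1 -[zeta x (c 1)]/(w 1) wE ?lexx ?ler01// mulr1 w0.
- by rewrite -w0.
Qed.

Lemma indicatrix_of_unit x z : E (x, z) -> bil (a x) z z = 1 -> K x (eta x z) = 1.
Proof.
move=> Exz z1; have [De ze] := lc_from L Exz; apply/(lc_unit L De).
by rewrite /Snorm -/(bil _ _ _) ze z1 sqrtr1.
Qed.

(** Conversely, the acceleration of a great circle is a multiple of its position,
    and [a(zeta, push v)] vanishes for [v] tangent to the indicatrix. *)
Lemma great_circle_geodesic x (z B : vec) s : U x -> 0 <= s ->
  bil (a x) z z = 1 ->
  s = 0 \/ bil (a x) z B = 0 /\ bil (a x) B B = 1 ->
  (forall t, 0 <= t <= 1 -> E (x, cos (s * t) *: z + sin (s * t) *: B)) ->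
  exists2 c, geodesic_arc D K x (eta x z) (eta x (cos s *: z + sin s *: B)) c
    & arc_length K x c = s / h.
Proof.
move=> Ux s0 zz H EW.
pose w t := cos (s * t) *: z + sin (s * t) *: B.
pose w1 t := (- s * sin (s * t)) *: z + (s * cos (s * t)) *: B.
have dw t : is_derive t (1 : R) w (w1 t).
  have [dc ds] := is_derive_trig s t; apply/is_derive_mx => r l.
  rewrite (_ : (fun t => _) = (fun t => cos (s * t) * z r l + sin (s * t) * B r l)).
    apply: (is_derive_eq (is_deriveD
      (is_derive_mul dc (is_derive_cst (z r l) t (1 : R)))
      (is_derive_mul ds (is_derive_cst (B r l) t (1 : R))))).
    by rewrite !mxE !mulr0 !addr0.
  by apply/funext => u; rewrite !mxE.
have dw1 t : is_derive t (1 : R) w1 (- s ^+ 2 *: w t).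
  have [dc ds] := is_derive_trig s t; apply/is_derive_mx => r l.
  rewrite (_ : (fun t => _) =
     (fun t => - s * sin (s * t) * z r l + s * cos (s * t) * B r l)).
    apply: (is_derive_eq (is_deriveD
      (is_derive_mul (is_derive_mul (is_derive_cst (- s) t (1 : R)) ds)
         (is_derive_cst (z r l) t (1 : R)))
      (is_derive_mul (is_derive_mul (is_derive_cst s t (1 : R)) dc)
         (is_derive_cst (B r l) t (1 : R))))).
    by rewrite !mxE /cst; ring.
  by apply/funext => u; rewrite !mxE.
have As := lc_sym L Ux.
have ww t : bil (a x) (w t) (w t) = 1 /\ bil (a x) (w1 t) (w1 t) = s ^+ 2.
  have e := cos2Dsin2 (s * t).
  case: H => [s00|[zB BB]].
    by rewrite /w /w1 s00 !mul0r cos0 sin0 !scale0r scale1r !addr0 oppr0 mul0r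
      scale0r zz bil0l expr0n.
  rewrite /w /w1 !(bilDl, bilDr, bilZl, bilZr) (bilC B z As) zz zB BB.
  split; first by apply: etrans e; ring.
  by transitivity (s ^+ 2 * (cos (s * t) ^+ 2 + sin (s * t) ^+ 2));
    [ring|rewrite e mulr1].
pose c t := eta x (w t).
have Dc t : 0 <= t <= 1 -> D (x, c t) /\ K x (c t) = 1.
  move=> t01; have [Dt _] := lc_from L (EW t t01); split=> //.
  by apply: indicatrix_of_unit; [exact: EW|have [] := ww t].
have Dc' t : 0 < t < 1 -> D (x, c t) /\ K x (c t) = 1.
  by move=> /andP[t0 t1]; apply: Dc; rewrite !ltW.
have zc t : 0 <= t <= 1 -> zeta x (c t) = w t.
  by move=> t01; have [_] := lc_from L (EW t t01).
pose c1 t : vec := \row_k \sum_l w1 t 0 l * pdy l (fun x z => eta x z 0 k) x (w t).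
have EW' t : 0 <= t <= 1 -> E (x, w t) by exact: EW.
have d1 t : 0 <= t <= 1 -> is_derive t (1 : R) c (c1 t).
  move=> t01; apply/is_derive_mx => r k; rewrite ord1 mxE.
  exact: (is_derive_curve (dw t) (eta_diff L k (EW' t t01))).
have c1E t : 0 <= t <= 1 -> derive1 c t = c1 t.
  by move=> t01; rewrite derive1E; have [_ ->] := d1 t t01.
have dc1 t : 0 < t < 1 -> derivable (derive1 c) t (1 : R).
  move=> t01; apply: (@near_eq_derivable _ _ _ c1).
    by apply: filterS (near_unit_itv t01) => u /andP[u0 u1]; rewrite c1E// !ltW.
  apply/derivable_mxP => r k; rewrite /c1; under eq_fun do rewrite mxE.
  apply: derivable_bigsum => l; apply: derivableM.
    by have /is_derive_mx/(_ 0 l)[] := dw1 t.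
  have de : differentiable (uncur (pdy l (fun x z => eta x z 0 k))) (x, w t).
    apply: Cxy_differentiable oE (Cxy_pdy l (lc_eta L k)) _.
    by case/andP: t01 => t0 t1; apply: EW'; rewrite !ltW.
  by have [] := is_derive_curve (dw t) de.
have dd1 t : 0 < t < 1 -> is_derive t (1 : R) c (derive1 c t).
  move=> /andP[t0 t1]; have t01 : 0 <= t <= 1 by rewrite !ltW.
  by rewrite c1E//; exact: d1.
have nearw t : 0 < t < 1 -> \forall u \near t, zeta x (c u) = w u.
  by move=> t01; apply: filterS (near_unit_itv t01) => u /andP[u0 u1]; rewrite zc// !ltW.
have vel t : 0 < t < 1 -> push zeta x (c t) (derive1 c t) = w1 t.
  move=> t01; have [Dt _] := Dc' t t01.
  have := near_eq_is_derive (nearw t t01) (is_derive_image Dt (dd1 t t01)).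
  by move/is_derive_uniq; apply.
exists c; last first.
  apply: arc_length_unit => // t t01; rewrite vel//; have [] := ww t => //.
split=> //.
- rewrite /c /w mulr0 mulr1 cos0 sin0 scale1r scale0r addr0//.
- apply/continuous_in_subspaceT => t; rewrite inE/= in_itv/= => t01.
  apply/differentiable_continuous/derivable1_diffP.
  by have [] := d1 t t01.
- by move=> t t01; split; [have [] := dd1 t t01|exact: dc1].
- move=> t t01 v vt; have [Dt Kt] := Dc' t t01.
  rewrite (geodesic_expr L (derive1 (derive1 c) t) Dt Kt (dK_curve Dc' t01 (dd1 t t01)) vt).
  have dd2 : is_derive t (1 : R) (derive1 c) (derive1 (derive1 c) t).
    by rewrite (derive1E (derive1 c)); apply/derivableP; exact: dc1.
  have nv : \forall u \near t, push zeta x (c u) (derive1 c u) = w1 u.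
    by apply: filterS (near_unit_itv t01) => u; exact: vel.
  have := is_derive_uniq (near_eq_is_derive nv
    (is_derive_velocity Dt (dd1 t t01) dd2)) (dw1 t).
  move=> ->; rewrite bilZl; case/andP: (t01) => t0 t1.
  have -> : w t = zeta x (c t) by rewrite zc// !ltW.
  by rewrite (dK_push L)// vt !mulr0.
Qed.

End Geodesics.

(** * The value of the angle *)

Section AngleValue.
Context {R : realType} {N : nat}.
Notation vec := ('rV[R]_N).
Variables (U : set vec) (K : vec -> vec -> R) (a : vec -> 'M[R]_N)
  (D E : set (vec * vec)) (zeta eta : vec -> vec -> vec) (h : R).
Hypothesis L : local_conformal U K a D E zeta eta h.
Implicit Types (x y z u v : vec) (c : R -> vec) (t s p q : R).

(** The image of the unit vector in the direction of [y] (see [zeta_unit]). *)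
Definition zunit x y : vec := K x y `^ (- h) *: zeta x y.

Lemma unit_in x y : D (x, y) -> D (x, unit_vec K x y) /\ K x (unit_vec K x y) = 1.
Proof.
move=> Dxy; have K0 := lc_Kgt0 L Dxy; have Ki : 0 < (K x y)^-1 by rewrite invr_gt0.
have D1 := lc_Dcone L Ki Dxy; rewrite /unit_vec; split; first by [].
by rewrite (lc_Khom L Dxy Ki) mulVf// gt_eqF.
Qed.

Lemma zeta_unit x y : D (x, y) -> zeta x (unit_vec K x y) = zunit x y.
Proof.
move=> Dxy; have K0 := lc_Kgt0 L Dxy; have Ki : 0 < (K x y)^-1 by rewrite invr_gt0.
rewrite /unit_vec (lc_hom L Dxy Ki) /zunit; congr (_ *: _).
have Kh0 : K x y `^ h != 0 by rewrite gt_eqF// powR_gt0.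
have Kn : K x y != 0 by rewrite gt_eqF.
by rewrite powRN; apply: (mulfI Kh0); rewrite -powRM ?ltW// !divff// powR1.
Qed.

Lemma zunit_in x y : D (x, y) -> E (x, zunit x y) /\ eta x (zunit x y) = unit_vec K x y.
Proof. by move=> Dxy; rewrite -zeta_unit//; apply: (lc_to L); have [] := unit_in Dxy. Qed.

Lemma bil_zunit x y : D (x, y) -> bil (a x) (zunit x y) (zunit x y) = 1.
Proof.
by move=> Dxy; rewrite -zeta_unit//; have [D1 K1] := unit_in Dxy; exact: (unit_image L).
Qed.

(** As [E] is invariant under positive scaling, this says at the same time that
    [E] contains the segment and the minor arc between [z1] and [z2]. *)
Definition cone x z1 z2 := forall p q, 0 <= p -> 0 <= q -> 0 < p + q ->
  E (x, p *: z1 + q *: z2).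

(** The squared length of the chord between the images of two directions. *)
Definition sqchord x y1 y2 : R :=
  bil (a x) (zunit x y1 - zunit x y2) (zunit x y1 - zunit x y2).

(** Spherical interpolation: the point of parameter [t] on the arc as a
    combination of the two ends. *)
Lemma slerp z1 B s t : sin s *: (cos (s * t) *: z1 + sin (s * t) *: B) =
  sin (s - s * t) *: z1 + sin (s * t) *: (cos s *: z1 + sin s *: B).
Proof. by apply/rowP => l; rewrite !mxE sinB; ring. Qed.

Lemma slerp_coef s t : 0 < s -> s < pi -> 0 <= t <= 1 ->
  [/\ 0 <= sin (s - s * t), 0 <= sin (s * t) & 0 < sin (s - s * t) + sin (s * t)].
Proof.
move=> s0 spi /andP[t0 t1].
have st0 : 0 <= s * t by rewrite mulr_ge0// ltW.
have sts : s * t <= s by rewrite ler_piMr// ltW.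
have H1 : 0 <= sin (s * t) by rewrite sin_ge0_pi// st0 (le_trans sts)// ltW.
have H2 : 0 <= sin (s - s * t).
  by rewrite sin_ge0_pi// subr_ge0 sts/= lerBlDr (le_trans (ltW spi))// lerDl.
split=> //; have [->|tn0] := eqVneq t 0.
  by rewrite mulr0 subr0 sin0 addr0 sin_gt0_pi// s0.
rewrite ltr_wpDl// sin_gt0_pi// mulr_gt0//=; last by rewrite lt_neqAle eq_sym tn0.
exact: le_lt_trans spi.
Qed.

(** The image of the arc is a great circle arc of angle [s = h * length < pi],
    hence the minor arc, which meets every ray of the cone spanned by its
    ends: the ratio of the two interpolation coefficients takes all values. *)
Lemma cone_of_geodesic x y1 y2 c : D (x, y1) -> D (x, y2) ->
  geodesic_arc D K x (unit_vec K x y1) (unit_vec K x y2) c ->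
  arc_length K x c < pi / h ->
  cone x (zunit x y1) (zunit x y2) /\ sqchord x y1 y2 < 4.
Proof.
move=> D1 D2 geo len; have h0 := lc_h L.
have [s [B [s0 ls EW zq H]]] := geodesic_great_circle L geo.
rewrite !zeta_unit// in EW zq H.
have spi : s < pi by move: len; rewrite ls ltr_pM2r ?invr_gt0.
have Q4 : sqchord x y1 y2 = 4 * sin (s / 2) ^+ 2.
  rewrite /sqchord zq; apply: sqchord_great_circle; [exact: (lc_sym L (lc_DU L D1))|exact: bil_zunit|exact: H].
split; last first.
  have cp : 0 < cos (s / 2).
    rewrite cos_gt0_pihalf// ltr_pM2r// spi andbT.
    by rewrite (lt_le_trans _ (divr_ge0 s0 _))// oppr_lt0 divr_gt0// pi_gt0.
  have cp2 : 0 < cos (s / 2) ^+ 2 by rewrite exprn_gt0.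
  by rewrite Q4; have := cos2Dsin2 (s / 2); lra.
move=> p q p0 q0 pq0.
have [s00|sn0] := eqVneq s 0.
  have -> : zunit x y2 = zunit x y1.
    by rewrite zq s00 cos0 sin0 scale1r scale0r addr0.
  by rewrite -scalerDl; apply: (lc_Econe L) => //; have [] := zunit_in D1.
have {sn0}s0 : 0 < s by rewrite lt_neqAle eq_sym sn0.
(* A zero of [f] is a parameter at which the coefficients of [slerp] are
   proportional to [p] and [q]. *)
pose f t := q * sin (s - s * t) - p * sin (s * t).
have fc : {within `[0, 1], continuous f}.
  apply: derivable_within_continuous => t _.
  have [_ ds] := is_derive_trig s t.
  have [dc _] := is_derive_trig s t.
  have -> : f = (fun t => q * (sin s * cos (s * t) - cos s * sin (s * t)) - p * sin (s * t)).
    by apply/funext => u; rewrite /f sinB.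
  apply: derivableB; last by apply: derivableM => //.
  apply: derivableM => //; apply: derivableB; exact: derivableM.
have [t t01 ft] : exists2 t, t \in `[0, 1] & f t = 0.
  apply: IVT => //.
  have f0 : 0 <= f 0.
    by rewrite /f mulr0 subr0 sin0 mulr0 subr0 mulr_ge0// ltW// sin_gt0_pi// s0.
  have f1 : f 1 <= 0.
    by rewrite /f mulr1 subrr sin0 mulr0 sub0r oppr_le0 mulr_ge0// ltW// sin_gt0_pi// s0.
  by rewrite ge_min le_max f0 f1 orbT.
have t01' : 0 <= t <= 1 by move: t01; rewrite in_itv.
have [al0 be0 ab0] := slerp_coef s0 spi t01'.
have ss0 : 0 < sin s by rewrite sin_gt0_pi// s0.
have Et := EW t t01'.
pose k := (p + q) / (sin (s - s * t) + sin (s * t)) * sin s.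
have k0 : 0 < k by rewrite mulr_gt0// divr_gt0.
have := lc_Econe L k0 Et.
rewrite /k -scalerA slerp -zq scalerDr !scalerA.
move: ft ab0; rewrite /f; set al := sin (s - _); set be := sin (s * t) => ft ab0.
have n0 : al + be != 0 by rewrite gt_eqF.
have -> : (p + q) / (al + be) * al = p.
  rewrite mulrAC; apply: (mulIf n0); rewrite divfK// mulrDl mulrDr; lra.
have -> // : (p + q) / (al + be) * be = q.
rewrite mulrAC; apply: (mulIf n0); rewrite divfK// mulrDl mulrDr; lra.
Qed.

Lemma sqchord_ge0 x y1 y2 : U x -> 0 <= sqchord x y1 y2.
Proof. by move=> Ux; apply: posdef_ge0; exact: (lc_pos L Ux). Qed.

(** The minor arc realizes the value.  Any other geodesic arc has the same
    chord, so its angle [s'] satisfies [|sin (s'/2)| = r], whence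
    [s' >= 2 asin r]. *)
Lemma angle_value x y1 y2 : D (x, y1) -> D (x, y2) ->
  cone x (zunit x y1) (zunit x y2) -> sqchord x y1 y2 < 4 ->
  angle D K x y1 y2 = 2 / h * asin (Num.sqrt (sqchord x y1 y2) / 2).
Proof.
move=> D1 D2 co Q4; have Ux := lc_DU L D1; have h0 := lc_h L.
have Q0 := sqchord_ge0 y1 y2 Ux; have As := lc_sym L Ux.
set r := Num.sqrt _ / 2; have r0 : 0 <= r by rewrite divr_ge0// sqrtr_ge0.
have r2 : sqchord x y1 y2 = 4 * r ^+ 2.
  by rewrite /r expr_div_n sqr_sqrtr//; field.
have r1 : r < 1.
  rewrite -(ltr_pXn2r (n := 2))// ?nnegrE// expr1n; lra.
have rb : -1 <= r <= 1 by rewrite (ltW r1) andbT (le_trans _ r0)// lerN10.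
pose s := asin r * 2.
have rs : sin (s / 2) = r by rewrite /s mulfK// asinK// in_itv.
have s0 : 0 <= s.
  rewrite mulr_ge0// leNgt; apply/negP => a0.
  have := @sin_gt0_pi R (- asin r); rewrite sinN asinK ?in_itv//= !oppr_gt0 a0/=.
  rewrite [r < 0]ltNge r0 => H; suff : false by []; apply: H.
  rewrite ltrNl (lt_le_trans _ (asin_geNpi2 rb))// ltrN2.
  by rewrite ltr_pdivrMr// ltr_pMr ?pi_gt0// ltr1n.
have spi : s < pi.
  by rewrite -ltr_pdivlMr// asin_ltpi2//; case/andP: rb => ->.
have z1u := bil_zunit D1; have z2u := bil_zunit D2.
have [E1 e1] := zunit_in D1; have [E2 e2] := zunit_in D2.
have z12 : bil (a x) (zunit x y1) (zunit x y2) = cos s.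
  have -> : cos s = 1 - 2 * r ^+ 2.
    rewrite (_ : s = s / 2 *+ 2); last by rewrite mulr2n -splitr.
    by rewrite cos_mulr2n; have := cos2Dsin2 (s / 2); rewrite rs; lra.
  move: r2; rewrite /sqchord !(bilBl, bilBr) z1u z2u (bilC (zunit x y2) (zunit x y1) As).
  lra.
have [B zq H] : exists2 B, zunit x y2 = cos s *: zunit x y1 + sin s *: B &
    s = 0 \/ bil (a x) (zunit x y1) B = 0 /\ bil (a x) B B = 1.
  have [s00|sn0] := eqVneq s 0.
    exists 0; last by left.
    rewrite s00 cos0 scale1r scaler0 addr0; apply/eqP; rewrite eq_sym -subr_eq0.
    apply/eqP/(posdef_eq0 (lc_pos L Ux)); rewrite -/(sqchord _ _ _) r2 -rs s00.
    by rewrite mul0r sin0 expr0n mulr0.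
  have ss0 : sin s != 0 by rewrite gt_eqF// sin_gt0_pi// spi lt_neqAle eq_sym sn0 s0.
  exists ((sin s)^-1 *: (zunit x y2 - cos s *: zunit x y1)).
    by rewrite (scalerA (sin s)) mulfV// scale1r addrC subrK.
  right; have e := cos2Dsin2 s.
  move: z12 z1u z2u; move: (zunit x y1) (zunit x y2) => z1 z2 z12 z1u z2u.
  rewrite !(bilZl, bilZr, bilDl, bilDr, bilNl, bilNr) (bilC z2 z1 As).
  rewrite z12 z1u z2u; split; first by ring.
  have -> : 1 - cos s * cos s = sin s ^+ 2 by rewrite -e; ring.
  field; exact: ss0.
have [c geo len] : exists2 c, geodesic_arc D K x (unit_vec K x y1) (unit_vec K x y2) c
    & arc_length K x c = s / h.
  rewrite -e1 -e2 [zunit x y2]zq; apply: (great_circle_geodesic L) => // t t01.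
  have [s00|sn0] := eqVneq s 0.
    by rewrite s00 mul0r cos0 sin0 scale1r scale0r addr0.
  have sp : 0 < s by rewrite lt_neqAle eq_sym sn0.
  have [al0 be0 ab0] := slerp_coef sp spi t01.
  have ss0 : 0 < sin s by rewrite sin_gt0_pi// sp.
  have si0 : 0 < (sin s)^-1 by rewrite invr_gt0.
  have := lc_Econe L si0 (co _ _ al0 be0 ab0).
  by rewrite zq -slerp scalerA mulVf ?gt_eqF// scale1r.
have -> : 2 / h * asin r = s / h by rewrite /s; field; rewrite gt_eqF.
rewrite /angle; apply/eqP; rewrite eq_le; apply/andP.
have lb : lbound [set l | exists2 c, geodesic_arc D K x (unit_vec K x y1) (unit_vec K x y2) c
    & l = arc_length K x c] (s / h).
  move=> _ [c' /(geodesic_great_circle L) [s' [B' [s'0 -> _ zq' H']]] ->].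
  rewrite !zeta_unit// in zq' H'.
  rewrite ler_pM2r ?invr_gt0//.
  have : sqchord x y1 y2 = 4 * sin (s' / 2) ^+ 2.
    by rewrite /sqchord zq'; apply: sqchord_great_circle.
  rewrite r2 => /(mulfI _) rr.
  have rE : r = `|sin (s' / 2)|.
    apply/eqP; rewrite -(eqrXn2 (n := 2))// real_normK ?num_real//.
    by apply/eqP/rr; rewrite pnatr_eq0.
  by rewrite /s -ler_pdivlMr// rE asin_sin_le// divr_ge0.
split; last by apply: lb_le_inf => //; exists (s / h); exists c.
by rewrite -len; apply: ge_inf; [exists (s / h)|exists c].
Qed.

End AngleValue.

(** * Differentiability of the angle *)

Section DerivativeAtZero.
Context {R : realType} {N : nat}.
Notation vec := ('rV[R]_N).

Lemma cvg_bigsum (T : Type) (F : set_system T) (FF : Filter F) (I : finType)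
    (f : I -> T -> R) (l : I -> R) :
  (forall k, f k @ F --> l k) -> (fun t => \sum_k f k t) @ F --> \sum_k l k.
Proof.
move=> H; elim: (index_enum I) => [|k s IH].
  by under eq_fun do rewrite big_nil; rewrite big_nil; exact: cvg_cst.
under eq_fun do rewrite big_cons; rewrite big_cons; exact: cvgD.
Qed.

(** When [u] vanishes at [p] together with its derivative, [sqrt (A(u, u))] is
    negligible with respect to the displacement.  This covers coinciding
    directions, where the square root itself is not differentiable. *)
Lemma is_derive_sqrt_bil0 (V : normedModType R) (p v : V) (A : V -> 'M[R]_N)
    (u : V -> vec) A' :
  is_derive p v A A' -> is_derive p v u 0 -> u p = 0 ->
  is_derive p v (fun q => Num.sqrt (bil (A q) (u q) (u q))) 0.
Proof.
move=> /is_derive_line dA /is_derive_line du u0; apply/is_derive_line.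
set B := fun t : R => A (t *: v + p) in dA.
set w := fun t : R => u (t *: v + p) in du.
have w0 : w 0 = 0 by rewrite /w scale0r add0r.
have quot k : (fun t : R => t^-1 * w t 0 k) @ (0 : R)^' --> (0 : R).
  have /is_derive_mx/(_ 0 k)[dw ew] := du.
  have E : (fun t : R => t^-1 * w t 0 k) =
    (fun t : R => t^-1 *: (w (t *: (1 : R^o) + 0) 0 k - w 0 0 k)).
    by apply/funext => t; rewrite w0 mxE subr0 addr0 [_%:A]mulr1.
  have H : (fun t : R => t^-1 * w t 0 k) @ (0 : R)^' -->
      'D_1 (fun t : R => w t 0 k) 0 by rewrite E; exact: dw.
  by rewrite ew mxE in H.
have cB m n : (fun t : R => B t m n) @ (0 : R)^' --> B 0 m n.
  have /is_derive_mx/(_ m n)[dB _] := dA.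
  apply: cvg_within_filter.
  exact: (differentiable_continuous ((derivable1_diffP _ _).1 dB)).
have lim0 : (fun t : R => \sum_m \sum_n B t m n * (t^-1 * w t 0 m) * (t^-1 * w t 0 n))
    @ (0 : R)^' --> (0 : R).
  have S0 : \sum_(m < N) \sum_(n < N) B 0 m n * 0 * 0 = 0.
    by rewrite big1// => m _; rewrite big1// => n _; rewrite mulr0.
  rewrite -[X in _ --> X]S0.
  apply: (@cvg_bigsum _ _ _ _ (fun m (t : R) =>
    \sum_n B t m n * (t^-1 * w t 0 m) * (t^-1 * w t 0 n))) => m.
  apply: (@cvg_bigsum _ _ _ _ (fun n (t : R) =>
    B t m n * (t^-1 * w t 0 m) * (t^-1 * w t 0 n))) => n.
  by apply: cvgM => //; exact: cvgM.
have sq : (fun t : R => t^-1 *: (Num.sqrt (bil (B t) (w t) (w t)) - 0))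
    @ (0 : R)^' --> (0 : R).
  apply: norm_cvg0.
  have H := cvg_comp _ _ lim0 (@sqrt_continuous R 0).
  rewrite sqrtr0 in H; apply: cvg_trans H; apply: near_eq_cvg; near=> t.
  have t0 : t != 0 by near: t; exact: nbhs_dnbhs_neq.
  rewrite /= subr0 normrM (ger0_norm (sqrtr_ge0 _)).
  rewrite -[`|t^-1|]sqrtr_sqr -sqrtrM ?sqr_ge0//; congr Num.sqrt.
  rewrite /bil mulr_sumr; apply: eq_bigr => m _; rewrite mulr_sumr.
  by apply: eq_bigr => n _; ring.
have E : (fun h : R => h^-1 *: (Num.sqrt (bil (B (h *: (1 : R^o) + 0)) (w (h *: (1 : R^o) + 0))
   (w (h *: (1 : R^o) + 0))) - Num.sqrt (bil (B 0) (w 0) (w 0)))) =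
   (fun t : R => t^-1 *: (Num.sqrt (bil (B t) (w t) (w t)) - 0)).
  by apply/funext => t; rewrite addr0 [_%:A]mulr1 w0 bil0l sqrtr0.
split; rewrite /derivable /derive /= E; first by apply/cvg_ex; exists 0.
exact: cvg_lim sq.
Unshelve. all: by end_near. Qed.

Lemma differentiable_row (V : normedModType R) (f : V -> vec) (p : V) :
  (forall j, differentiable (fun q => f q 0 j) p) -> differentiable f p.
Proof.
move=> H; have -> : f = \sum_j (fun q => f q 0 j *: base j).
  by apply/funext => q; rewrite fct_sumE -rV_base.
by apply: differentiable_sum => j; exact: differentiableZl.
Qed.

Lemma differentiable_fst (V W : normedModType R) (p : V * W) : differentiable fst p.
Proof. by apply: (linear_differentiable (f := fst)) => q; exact: cvg_fst. Qed.

Lemma differentiable_snd (V W : normedModType R) (p : V * W) : differentiable snd p.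
Proof. by apply: (linear_differentiable (f := snd)) => q; exact: cvg_snd. Qed.

End DerivativeAtZero.

Section Tube.
Context {R : realType} {N : nat}.
Notation vec := ('rV[R]_N).
Variables (U : set vec) (K : vec -> vec -> R) (a : vec -> 'M[R]_N)
  (D E : set (vec * vec)) (zeta eta : vec -> vec -> vec) (h : R).
Hypothesis L : local_conformal U K a D E zeta eta h.
Notation triple := (vec * (vec * vec))%type.
Implicit Types (x y z u v : vec) (p q : triple).

Definition leg1 (q : triple) : vec * vec := (q.1, q.2.1).
Definition leg2 (q : triple) : vec * vec := (q.1, q.2.2).

Lemma leg1_diff p : differentiable leg1 p.
Proof.
apply: differentiable_pair; first exact: differentiable_fst.
apply: (@differentiable_comp _ _ _ _ snd fst); first exact: differentiable_snd.
exact: differentiable_fst.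
Qed.

Lemma leg2_diff p : differentiable leg2 p.
Proof.
apply: differentiable_pair; first exact: differentiable_fst.
apply: (@differentiable_comp _ _ _ _ snd snd); first exact: differentiable_snd.
exact: differentiable_snd.
Qed.

Lemma zunit_diff j x y : D (x, y) ->
  differentiable (uncur (fun x y => zunit K zeta h x y 0 j)) (x, y).
Proof.
move=> Dxy; have K0 := lc_Kgt0 L Dxy.
have -> : uncur (fun x y => zunit K zeta h x y 0 j) =
   (fun w => uncur K w `^ (- h)) * (uncur (fun x y => zeta x y 0 j)).
  by apply/funext => w; rewrite /uncur /zunit mxE.
apply: differentiableM; last exact: (zeta_diff L j Dxy).
exact: (differentiable_real (p := (x, y)) (g := uncur K)
    (is_derive1_powR (- h) K0) (K_diff L Dxy)).
Qed.

Let z1 q := zunit K zeta h q.1 q.2.1.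
Let z2 q := zunit K zeta h q.1 q.2.2.
Let ch q := sqchord K a zeta h q.1 q.2.1 q.2.2.

Lemma z1_diff j p : D (leg1 p) -> differentiable (fun q => z1 q 0 j) p.
Proof. by case: p => x [y y'] D1; exact: (differentiable_comp (leg1_diff _) (zunit_diff j D1)). Qed.

Lemma z2_diff j p : D (leg2 p) -> differentiable (fun q => z2 q 0 j) p.
Proof. by case: p => x [y y'] D1; exact: (differentiable_comp (leg2_diff _) (zunit_diff j D1)). Qed.

Lemma sqchord_diff p : D (leg1 p) -> D (leg2 p) -> differentiable ch p.
Proof.
move=> D1 D2; have Ux := lc_DU L D1.
have dz j : differentiable (fun q => (z1 q - z2 q) 0 j) p.
  rewrite (_ : (fun q => _) = (fun q => z1 q 0 j) - (fun q => z2 q 0 j)).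
    by apply: differentiableB; [exact: z1_diff|exact: z2_diff].
  by apply/funext => q; rewrite mxE [X in _ + X]mxE.
apply: differentiable_bil => // m n.
by case: p D1 D2 Ux dz => x yy D1 _ Ux _; exact: (differentiable_fst_comp yy (metric_diff L m n Ux)).
Qed.

(** The segment is compact, [E] is open, and the segment depends continuously
    on [x], [y1] and [y2]. *)
Lemma near_cone p : D (leg1 p) -> D (leg2 p) -> cone E p.1 (z1 p) (z2 p) ->
  \forall q \near p, cone E q.1 (z1 q) (z2 q).
Proof.
move=> D1 D2 co.
pose G (w : R * triple) := (w.2.1, (1 - w.1) *: z1 w.2 + w.1 *: z2 w.2).
have dG (t : R) : differentiable G (t, p).
  apply: differentiable_pair.
    apply: (@differentiable_comp _ _ _ _ snd fst); first exact: differentiable_snd.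
    exact: differentiable_fst.
  apply: differentiable_row => j.
  rewrite (_ : (fun w => _) = (cst 1 - (fst : R * triple -> R)) * ((fun q => z1 q 0 j) \o snd)
     + (fst : R * triple -> R) * ((fun q => z2 q 0 j) \o snd)); last first.
    by apply/funext => w; rewrite mxE [X in X + _]mxE [X in _ + X]mxE.
  have ds : differentiable (snd : R * triple -> triple) (t, p) by exact: differentiable_snd.
  have df : differentiable (fst : R * triple -> R) (t, p) by exact: differentiable_fst.
  have d1 := @differentiable_comp _ _ _ _ snd (fun q => z1 q 0 j) (t, p) ds (z1_diff j D1).
  have d2 := @differentiable_comp _ _ _ _ snd (fun q => z2 q 0 j) (t, p) ds (z2_diff j D2).
  apply: differentiableD; apply: differentiableM => //.
  by apply: differentiableB => //; exact: differentiable_cst.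
have cov : \forall q \near p, `[0, 1]%classic `<=` (fun t : R => E (G (t, q))).
  have /compact_near_coveringP nc := @segment_compact R 0 1.
  apply: (nc triple (nbhs p) (fun q t => E (G (t, q))) _ _) => t.
  rewrite /= in_itv/= => /andP[t0 t1].
  have Et : E (G (t, p)) by apply: co; rewrite ?subr_ge0 ?subrK.
  have nE : nbhs (G (t, p)) E by apply: open_nbhs_nbhs; split => //; exact: (lc_openE L).
  have := differentiable_continuous (dG t) nE.
  by move=> [[A B] /= [tA pB] AB]; exists (A, B) => // -[t' q] [/= At' Bq]; exact: (AB (t', q)).
apply: filterS cov => q cq r s r0 s0 rs0.
have rs : r + s != 0 by rewrite gt_eqF.
have := cq (s / (r + s)); rewrite /= in_itv/= divr_ge0 ?(ltW rs0)//=.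
rewrite ler_pdivrMr// mul1r lerDr r0 => /(_ isT) Et.
have := lc_Econe L rs0 Et; rewrite scalerDr !scalerA.
have -> : (r + s) * (1 - s / (r + s)) = r by field.
by have -> : (r + s) * (s / (r + s)) = s by field.
Qed.

Let theta q := 2 / h * asin (Num.sqrt (ch q) / 2).

Lemma near_angle p : D (leg1 p) -> D (leg2 p) -> cone E p.1 (z1 p) (z2 p) -> ch p < 4 ->
  \forall q \near p, theta q = angle D K q.1 q.2.1 q.2.2.
Proof.
move=> D1 D2 co Q4; have oD := lc_openD L.
have n1 : \forall q \near p, D (leg1 q).
  apply: (differentiable_continuous (leg1_diff p)).
  exact: open_nbhs_nbhs.
have n2 : \forall q \near p, D (leg2 q).
  apply: (differentiable_continuous (leg2_diff p)).
  exact: open_nbhs_nbhs.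
have n3 : \forall q \near p, ch q < 4.
  exact: (cvgr_lt _ (differentiable_continuous (sqchord_diff D1 D2))).
have n4 := near_cone D1 D2 co.
near=> q; rewrite (angle_value L)//; by near: q.
Unshelve. all: by end_near. Qed.

End Tube.

Section Slices3.
Context {R : realType} {V0 V1 V2 : normedModType R}.
Variables (F : V0 * (V1 * V2) -> R) (x : V0) (y : V1) (z : V2) (l : R).

Lemma derive_slice0 e : is_derive (x, (y, z)) (e, (0, 0)) F l ->
  is_derive x e (fun x' => F (x', (y, z))) l.
Proof.
move=> /is_derive_line H; apply/is_derive_line; move: H.
rewrite (_ : (fun t : R => _) = (fun t : R => F (t *: e + x, (y, z))))//.
by apply/funext => t; congr (F (_, (_, _))); rewrite /= scaler0 add0r.
Qed.

Lemma derive_slice1 e : is_derive (x, (y, z)) (0, (e, 0)) F l ->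
  is_derive y e (fun y' => F (x, (y', z))) l.
Proof.
move=> /is_derive_line H; apply/is_derive_line; move: H.
rewrite (_ : (fun t : R => _) = (fun t : R => F (x, (t *: e + y, z))))//.
by apply/funext => t; congr (F (_, (_, _))); rewrite /= scaler0 add0r.
Qed.

Lemma derive_slice2 e : is_derive (x, (y, z)) (0, (0, e)) F l ->
  is_derive z e (fun z' => F (x, (y, z'))) l.
Proof.
move=> /is_derive_line H; apply/is_derive_line; move: H.
rewrite (_ : (fun t : R => _) = (fun t : R => F (x, (y, t *: e + z))))//.
by apply/funext => t; congr (F (_, (_, _))); rewrite /= scaler0 add0r.
Qed.

End Slices3.

Section AngleTransport.
Context {R : realType} {N : nat}.
Notation vec := ('rV[R]_N).
Variables (U : set vec) (K : vec -> vec -> R) (a : vec -> 'M[R]_N)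
  (D E : set (vec * vec)) (zeta eta : vec -> vec -> vec) (h : R).
Hypothesis L : local_conformal U K a D E zeta eta h.
Implicit Types (x y z u v : vec) (i j k : 'I_N).

Let Nr i x y : vec := \row_k Nco zeta eta a k i x y.
Let alpha3 (q : vec * (vec * vec)) := angle D K q.1 q.2.1 q.2.2.

Lemma is_derive_zunit i x y : D (x, y) ->
  is_derive (x, y) (base i, Nr i x y) (fun w => zunit K zeta h w.1 w.2)
    (- conn a x i (zunit K zeta h x y)).
Proof.
move=> Dxy; have K0 := lc_Kgt0 L Dxy.
have dK : is_derive (x, y) (base i, Nr i x y) (uncur K) 0.
  by apply: (is_derive_eq (dop_derive _ i (K_diff L Dxy))); exact: (dop_K L).
have dk := is_derive_comp_real (F := uncur K) (p := (x, y)) (is_derive1_powR (- h) K0) dK.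
have /is_derive_mx dz := is_derive_zeta L i Dxy.
apply/is_derive_mx => r j; rewrite (_ : (fun w => _) =
  (fun w => uncur K w `^ (- h) * zeta w.1 w.2 r j)); last first.
  by apply/funext => w; rewrite mxE.
apply: (is_derive_eq (is_derive_mul dk (dz r j))).
rewrite mulr0 mul0r add0r /uncur/= /zunit.
by rewrite linearZ/= -scalerN [RHS]mxE.
Qed.

Section AtPoint.
Variables (x y1 y2 : vec) (i : 'I_N).
Hypotheses (D1 : D (x, y1)) (D2 : D (x, y2)).
Hypothesis co : cone E x (zunit K zeta h x y1) (zunit K zeta h x y2).
Hypothesis Q4 : sqchord K a zeta h x y1 y2 < 4.

Let p : vec * (vec * vec) := (x, (y1, y2)).
Let d : vec * (vec * vec) := (base i, (Nr i x y1, Nr i x y2)).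
Let ch (q : vec * (vec * vec)) := sqchord K a zeta h q.1 q.2.1 q.2.2.

(** Both normalized images are parallel along [d], hence so is their
    difference. *)
Lemma is_derive_sqrt_chord : is_derive p d (fun q => Num.sqrt (ch q)) 0.
Proof.
have Ux := lc_DU L D1.
have d1 : is_derive p d (fun q => zunit K zeta h q.1 q.2.1) (- conn a x i (zunit K zeta h x y1)).
  by have /is_derive_line H := is_derive_zunit i D1; apply/is_derive_line; exact: H.
have d2 : is_derive p d (fun q => zunit K zeta h q.1 q.2.2) (- conn a x i (zunit K zeta h x y2)).
  by have /is_derive_line H := is_derive_zunit i D2; apply/is_derive_line; exact: H.
have dd : is_derive p d (fun q => zunit K zeta h q.1 q.2.1 - zunit K zeta h q.1 q.2.2)
    (- conn a x i (zunit K zeta h x y1 - zunit K zeta h x y2)).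
  apply: (is_derive_eq (is_deriveB d1 d2)).
  by rewrite linearB/= opprB opprK addrC.
have da : is_derive p d (fun q => a q.1) (dmetric a i x).
  exact: (is_derive_fst _ _ (is_derive_metric (lc_openU L) (lc_a L) i Ux)).
have [z0|z0] := eqVneq (zunit K zeta h x y1 - zunit K zeta h x y2) 0.
  apply: (is_derive_sqrt_bil0 da); last by rewrite z0.
  by apply: (is_derive_eq dd); rewrite z0 linear0 oppr0.
have chp : 0 < ch p by exact: (lc_pos L Ux).
have dch : is_derive p d ch 0.
  apply: (is_derive_eq (is_derive_bil da dd dd)).
  rewrite (metricity (lc_openU L) (lc_sym L) (lc_pos L))// bilNl bilNr.
  by move: (bil _ _ _) (bil _ _ _) => b1 b2; ring.
apply: (is_derive_eq (is_derive_comp_real (F := ch) (p := p) (is_derive1_sqrt chp) dch)).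
by rewrite mulr0.
Qed.

Lemma half_chord_lt1 : -1 < Num.sqrt (ch p) / 2 < 1.
Proof.
have s0 : 0 <= Num.sqrt (ch p) / 2 by rewrite divr_ge0// sqrtr_ge0.
rewrite (lt_le_trans _ s0)//= ?ltrN10// -(ltr_pXn2r (n := 2))// ?nnegrE//.
rewrite expr1n expr_div_n sqr_sqrtr ?(sqchord_ge0 L)//; last exact: (lc_DU L D1).
by rewrite ltr_pdivrMr ?exprn_gt0// mul1r (lt_le_trans Q4)// expr2 -natrM.
Qed.

Lemma is_derive_angle : is_derive p d alpha3 0.
Proof.
apply: (near_eq_is_derive (near_angle L (p := p) D1 D2 co Q4)).
have d1 := is_derive_mul is_derive_sqrt_chord (is_derive_cst (2^-1 : R) p d).
have d2 := is_derive_comp_real (F := fun q => Num.sqrt (ch q) / 2) (p := p)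
  (is_derive1_asin half_chord_lt1) d1.
apply: (is_derive_eq (is_derive_mul (is_derive_cst (2 / h) p d) d2)).
by rewrite !(mulr0, mul0r, addr0).
Qed.

(** For distinct directions the chord is positive, so that the square root is
    differentiable. *)
Lemma angle_differentiable : unit_vec K x y1 <> unit_vec K x y2 ->
  differentiable alpha3 p.
Proof.
move=> u12; have Ux := lc_DU L D1.
have z0 : zunit K zeta h x y1 - zunit K zeta h x y2 != 0.
  apply/eqP => /eqP; rewrite subr_eq0 => /eqP z12; apply: u12.
  by have [_ <-] := zunit_in L D1; have [_ <-] := zunit_in L D2; rewrite z12.
have chp : 0 < ch p by exact: (lc_pos L Ux).
apply: (near_eq_differentiable (near_angle L (p := p) D1 D2 co Q4)).
have e1 : differentiable (fun q => Num.sqrt (ch q)) p.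
  exact: (differentiable_real (g := ch) (p := p) (is_derive1_sqrt chp) (sqchord_diff L (p := p) D1 D2)).
have e2 : differentiable (fun q => Num.sqrt (ch q) / 2) p.
  by apply: differentiableM.
apply: differentiableM => //.
exact: (differentiable_real (g := fun q => Num.sqrt (ch q) / 2) (p := p)
  (is_derive1_asin half_chord_lt1) e2).
Qed.

Lemma angle_line :
  is_derive (0 : R) (1 : R) (fun t : R => angle D K (x + t *: base i)
    (y1 + t *: Nr i x y1) (y2 + t *: Nr i x y2)) 0.
Proof.
have /is_derive_line H := is_derive_angle.
rewrite (_ : (fun t => _) = (fun t => alpha3 (t *: d + p))); first exact: H.
by apply/funext => t; rewrite /alpha3/= ![_ + t *: _]addrC.
Qed.

(** The differential of the angle at the direction [d], split into the three
    groups of variables. *)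
Lemma angle_partials : unit_vec K x y1 <> unit_vec K x y2 ->
  [/\ derivable (fun x' => angle D K x' y1 y2) x (base i),
      forall k, derivable (fun y => angle D K x y y2) y1 (base k),
      forall k, derivable (fun y => angle D K x y1 y) y2 (base k) &
      pd i (fun x' => angle D K x' y1 y2) x
      + \sum_k Nco zeta eta a k i x y1 * pd k (fun y => angle D K x y y2) y1
      + \sum_k Nco zeta eta a k i x y2 * pd k (fun y => angle D K x y1 y) y2 = 0].
Proof.
move=> /angle_differentiable df.
have sl (v : vec * (vec * vec)) : is_derive p v alpha3 ('d alpha3 p v).
  by rewrite -deriveE//; apply/derivableP; exact: diff_derivable.
have sx := derive_slice0 (sl (base i, (0, 0))).
have s1 k := derive_slice1 (sl (0, (base k, 0))).
have s2 k := derive_slice2 (sl (0, (0, base k))).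
split=> [|k|k|]; [by have [] := sx|by have [] := s1 k|by have [] := s2 k|].
have := is_derive_uniq (sl d) is_derive_angle.
have -> : d = (base i, (0, 0)) + \sum_k Nco zeta eta a k i x y1 *: (0, (base k, 0))
   + \sum_k Nco zeta eta a k i x y2 *: (0, (0, base k)).
  have inj1 (s : seq 'I_N) (f : 'I_N -> R) : \sum_(k <- s) f k *: ((0 : vec), (base k, (0 : vec)))
      = (0, (\sum_(k <- s) f k *: base k, 0)).
    elim: s => [|k s IH]; first by rewrite !big_nil.
    rewrite !big_cons IH; congr (_, (_, _)); rewrite /= ?scaler0 ?addr0//.
  have inj2 (s : seq 'I_N) (f : 'I_N -> R) : \sum_(k <- s) f k *: ((0 : vec), ((0 : vec), base k))
      = (0, (0, \sum_(k <- s) f k *: base k)).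
    elim: s => [|k s IH]; first by rewrite !big_nil.
    rewrite !big_cons IH; congr (_, (_, _)); rewrite /= ?scaler0 ?addr0//.
  rewrite inj1 inj2 /d; congr (_, (_, _)) => /=; rewrite ?addr0 ?add0r//.
    by rewrite [LHS]rV_base; apply: eq_bigr => k _; rewrite mxE.
  by rewrite [LHS]rV_base; apply: eq_bigr => k _; rewrite mxE.
rewrite !linearD !linear_sum /= => E0; rewrite -[RHS]E0.
congr (_ + _ + _).
- by have [_] := sx.
- by apply: eq_bigr => k _; rewrite linearZ/=; congr (_ * _); have [_] := s1 k.
- by apply: eq_bigr => k _; rewrite linearZ/=; congr (_ * _); have [_] := s2 k.
Qed.

End AtPoint.

End AngleTransport.

(** * The theorem *)

Lemma chart_local_conformal {R : realType} {N : nat} (M : manifold R N)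
  (K : chart M -> 'rV[R]_N -> 'rV[R]_N -> R)
  (a : chart M -> 'rV[R]_N -> 'M[R]_N)
  (D E : chart M -> set ('rV[R]_N * 'rV[R]_N))
  (zeta eta : chart M -> 'rV[R]_N -> 'rV[R]_N -> 'rV[R]_N) (h : R) (c : chart M) :
  finsler_metric K -> riemannian_metric a ->
  conformal_isomorphism K a D E zeta eta h ->
  local_conformal (img c) (K c) (a c) (D c) (E c) (zeta c) (eta c) h.
Proof.
move=> HK Ha [[[oD Dslit Dcone _] [oE _ Econe _] _ to from rz re] h0 hom unit metric].
have inD x y : D c (x, y) -> img c x /\ y != 0 by move/Dslit.
apply: LocalConformal.
- exact: crd_open.
- exact: oD.
- exact: oE.
- by move=> x y /inD[].
- by move=> x y gam; exact: Dcone.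
- by move=> x z gam; exact: Econe.
- by move=> x y; exact: to.
- by move=> x z; exact: from.
- exact: rz.
- exact: re.
- exact: (Cxy_sub (Dslit c) (finsler_reg HK c)).
- by move=> x y /inD[Ux y0]; exact: (finsler_gt0 HK).
- by move=> x y gam /inD[Ux y0] gam0; exact: (finsler_hom HK).
- by move=> i j; exact: (riem_reg Ha).
- by move=> x Ux; exact: (riem_sym Ha).
- by move=> x Ux v v0; exact: (riem_pos Ha).
- exact: h0.
- by move=> x y gam; exact: hom.
- by move=> x y; exact: unit.
- by move=> x y m n; exact: metric.
Qed.

Theorem theorem2p5 (R : realType) (N : nat) (M : manifold R N)
  (K : chart M -> 'rV[R]_N -> 'rV[R]_N -> R)
  (a : chart M -> 'rV[R]_N -> 'M[R]_N)
  (D E : chart M -> set ('rV[R]_N * 'rV[R]_N))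
  (zeta eta : chart M -> 'rV[R]_N -> 'rV[R]_N -> 'rV[R]_N) (h : R)
  (HK : finsler_metric K) (Ha : riemannian_metric a)
  (Hzeta : conformal_isomorphism K a D E zeta eta h) (c : chart M) :
  let Nc := Nco (zeta c) (eta c) (a c) in
  let alpha := angle (D c) (K c) in
  (forall x y, D c (x, y) ->
    (forall i j, Nc j i x y = - \sum_k Dco Nc j i k x y * y 0 k) /\
    [/\ forall i, cov00 Nc i (K c) x y = 0,
        forall i j, cov10 Nc i (fun k _ y' => y' 0 k) j x y = 0,
        forall i j, cov01 Nc i (ylow (K c)) j x y = 0 &
        forall i j n, cov02 Nc i (gten (K c)) j n x y = 0]) /\
  (forall x y1 y2, D c (x, y1) -> D c (x, y2) ->
    (exists2 arc,
       geodesic_arc (D c) (K c) x (unit_vec (K c) x y1) (unit_vec (K c) x y2)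
         arc &
       arc_length (K c) x arc < pi / h) ->
    forall i,
      is_derive (0 : R) (1 : R)
        (fun t : R => alpha (x + t *: base i)
           (y1 + t *: \row_k Nc k i x y1) (y2 + t *: \row_k Nc k i x y2)) 0 /\
      (unit_vec (K c) x y1 <> unit_vec (K c) x y2 ->
        [/\ derivable (fun x' => alpha x' y1 y2) x (base i),
            forall k, derivable (fun y => alpha x y y2) y1 (base k),
            forall k, derivable (fun y => alpha x y1 y) y2 (base k) &
            pd i (fun x' => alpha x' y1 y2) x
            + \sum_k Nc k i x y1 * pd k (fun y => alpha x y y2) y1
            + \sum_k Nc k i x y2 * pd k (fun y => alpha x y1 y) y2 = 0])).
Proof.
move=> Nc alpha; have L := chart_local_conformal c HK Ha Hzeta.
split=> [x y Dxy|x y1 y2 D1 D2 [arc geo len] i].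
  split=> [i j|].
    apply: (etrans (esym (Nc_euler L j i Dxy))).
    rewrite -sumrN; apply: eq_bigr => k _.
    by rewrite /Dco mulNr opprK; exact: mulrC.
  split=> [i|i j|i j|i j n].
  - exact: (dop_K L i Dxy).
  - exact: (cov_y L i j Dxy).
  - exact: (cov_ylow L i j Dxy).
  - exact: (cov_g L i j n Dxy).
have [co Q4] := cone_of_geodesic L D1 D2 geo len.
split; first exact: (angle_line L i D1 D2 co Q4).
exact: (angle_partials L i D1 D2 co Q4).
Qed.
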